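(* For every real $s\le0$, $\mathcal{H}_s$ is not weakly related to the Bergman space $A^2(\mathbb{D})$; that is, there is no invertible weighted composition operator $W_{\lambda,\varphi}:A^2(\mathbb{D})\to\mathcal{H}_s$.
   Context: $\mathbb{D}$ is the open unit disc in $\mathbb{C}$. For real $s$, $\mathcal{H}_s$ is the Hilbert space of holomorphic functions with reproducing kernel $K_s(z,w)=G_s(z\overline{w})$, where $G_s(t)=\sum_{n=0}^\infty(n+1)^st^n$; thus the monomials $z^n$ form a complete orthogonal set with $\|z^n\|^2_{\mathcal{H}_s}=(n+1)^{-s}$. It is regarded as a space of functions on its natural maximal domain, which is $\mathbb{D}$ for $s\ge-1$ and $\overline{\mathbb{D}}$ for $s<-1$ (functions then extend continuously to $\overline{\mathbb{D}}$). The Bergman space is $A^2(\mathbb{D})=\mathcal{H}_1$ (i.e. $s=1$), and the Hardy space $H^2(\mathbb{D})$ is $\mathcal{H}_0$. For Hilbert function spaces $\mathcal{K}_i$ on sets $X_i$, $i=1,2$, a weighted composition operator $W_{\lambda,\varphi}:\mathcal{K}_2\to\mathcal{K}_1$ is a bounded operator $f\mapsto\lambda\,(f\circ\varphi)$ with $\varphi:X_1\to X_2$ and $\lambda:X_1\to\mathbb{C}$; it is invertible if it is a bounded bijection (its inverse need not be a weighted composition operator). $\mathcal{K}_1$ is weakly related to $\mathcal{K}_2$ if there is an invertible weighted composition operator $\mathcal{K}_2\to\mathcal{K}_1$. *)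

(* Defs.v *)
From Stdlib Require Import Reals Lra Lia ClassicalEpsilon FunctionalExtensionality.
From Coquelicot Require Import Coquelicot.
Open Scope R_scope.

Definition norm_of {V : Type} (inner : V -> V -> C) (f : V) : R :=
  sqrt (Re (inner f f)).

(** [inner] is a total function on [X -> C]; it is meaningful only on members
    of the space, and every axiom is restricted to members. *)
Record HilbertFunctionSpace (X : Type) := {
  mem : (X -> C) -> Prop;
  inner : (X -> C) -> (X -> C) -> C;
  mem_zero : mem (fun _ => RtoC 0);
  mem_plus : forall f g, mem f -> mem g -> mem (fun x => (f x + g x)%C);
  mem_scal : forall c f, mem f -> mem (fun x => (c * f x)%C);
  inner_plus : forall f g h, mem f -> mem g -> mem h ->
    inner (fun x => (f x + g x)%C) h = (inner f h + inner g h)%C;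
  inner_scal : forall c f g, mem f -> mem g ->
    inner (fun x => (c * f x)%C) g = (c * inner f g)%C;
  inner_conj : forall f g, mem f -> mem g -> inner g f = Cconj (inner f g);
  inner_pos : forall f, mem f -> 0 <= Re (inner f f);
  inner_definite : forall f, mem f -> inner f f = RtoC 0 -> forall x, f x = RtoC 0;
  complete : forall u : nat -> X -> C,
    (forall n, mem (u n)) ->
    (forall eps, 0 < eps -> exists N, forall m n, (N <= m)%nat -> (N <= n)%nat ->
       norm_of inner (fun x => (u m x - u n x)%C) < eps) ->
    exists f, mem f /\
      forall eps, 0 < eps -> exists N, forall n, (N <= n)%nat ->
        norm_of inner (fun x => (u n x - f x)%C) < eps;
  eval_bounded : forall x, exists M, forall f, mem f ->
    Cmod (f x) <= M * norm_of inner f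
}.
Arguments mem {X} _ _.
Arguments inner {X} _ _ _.

Definition hnorm {X : Type} (H : HilbertFunctionSpace X) (f : X -> C) : R :=
  norm_of (inner H) f.

Definition reproducing_kernel {X : Type} (H : HilbertFunctionSpace X)
    (K : X -> X -> C) : Prop :=
  forall w, mem H (fun z => K z w) /\
    forall f, mem H f -> f w = inner H f (fun z => K z w).

Definition wco {X1 X2 : Type} (lambda : X1 -> C) (phi : X1 -> X2)
    (f : X2 -> C) : X1 -> C :=
  fun x => (lambda x * f (phi x))%C.

Definition is_wco {X1 X2 : Type} (K1 : HilbertFunctionSpace X1)
    (K2 : HilbertFunctionSpace X2) (lambda : X1 -> C) (phi : X1 -> X2) : Prop :=
  (forall f, mem K2 f -> mem K1 (wco lambda phi f)) /\
  exists M, forall f, mem K2 f -> hnorm K1 (wco lambda phi f) <= M * hnorm K2 f.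

Definition invertible_wco {X1 X2 : Type} (K1 : HilbertFunctionSpace X1)
    (K2 : HilbertFunctionSpace X2) (lambda : X1 -> C) (phi : X1 -> X2) : Prop :=
  is_wco K1 K2 lambda phi /\
  (forall f g, mem K2 f -> mem K2 g ->
     (forall x, wco lambda phi f x = wco lambda phi g x) -> forall y, f y = g y) /\
  (forall h, mem K1 h ->
     exists f, mem K2 f /\ forall x, wco lambda phi f x = h x).

Definition weakly_related {X1 X2 : Type} (K1 : HilbertFunctionSpace X1)
    (K2 : HilbertFunctionSpace X2) : Prop :=
  exists (lambda : X1 -> C) (phi : X1 -> X2), invertible_wco K1 K2 lambda phi.

(** The natural maximal domain of [H_s]: the open unit disc when [-1 <= s], the
    closed unit disc when [s < -1]. *)
Definition in_dom (s : R) (z : C) : Prop :=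
  (-1 <= s /\ Cmod z < 1) \/ (s < -1 /\ Cmod z <= 1).

Definition dom (s : R) : Type := sig (in_dom s).

Definition pt {s : R} (z : dom s) : C := proj1_sig z.

(** As with [Series], the value is meaningful only for a convergent series. *)
Definition CSeries (u : nat -> C) : C :=
  (Series (fun n => Re (u n)), Series (fun n => Im (u n))).

Definition Hs_kernel (s : R) (z w : dom s) : C :=
  CSeries (fun n => (RtoC (Rpower (INR (S n)) s) * (pt z * Cconj (pt w)) ^ n)%C).

(** The squared norm [(n+1)^(-s)] of the monomial [z^n] in [H_s], dual to the
    coefficients [(n+1)^s] of the kernel; see [Hs_reproducing_kernel]. *)
Definition weight (s : R) (n : nat) : R := Rpower (INR (S n)) (- s).

(** The first condition is finiteness of the [H_s] norm; the series is required
    to converge to [f] on the whole domain, boundary included when [s < -1]. *)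
Definition has_coef (s : R) (f : dom s -> C) (a : nat -> C) : Prop :=
  ex_series (fun n => weight s n * Cmod (a n) ^ 2) /\
  forall z : dom s,
    @is_series C_AbsRing C_NormedModule (fun n => (a n * pt z ^ n)%C) (f z).

Definition Hs_mem (s : R) (f : dom s -> C) : Prop := exists a, has_coef s f a.

(** The power series coefficients of a member of [H_s] (unique by
    [has_coef_unique] below). *)
Definition coef (s : R) (f : dom s -> C) : nat -> C :=
  epsilon (inhabits (fun _ => RtoC 0)) (has_coef s f).

Definition Hs_inner (s : R) (f g : dom s -> C) : C :=
  CSeries (fun n => (RtoC (weight s n) * (coef s f n * Cconj (coef s g n)))%C).

Lemma Cmod_sq (c : C) : Cmod c ^ 2 = Re c ^ 2 + Im c ^ 2.
Proof.
unfold Cmod, Re, Im. rewrite pow2_sqrt; auto.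
assert (H1 := pow2_ge_0 (fst c)); assert (H2 := pow2_ge_0 (snd c)); lra.
Qed.

Lemma sum_n_C (u : nat -> C) N :
  @sum_n C_AbelianMonoid u N =
  (sum_n (fun n => Re (u n)) N, sum_n (fun n => Im (u n)) N).
Proof.
induction N as [|N IH].
- rewrite !sum_O. now destruct (u O).
- rewrite !sum_Sn, IH. reflexivity.
Qed.

Lemma is_series_C (u : nat -> C) (l : C) :
  @is_series C_AbsRing C_NormedModule u l <->
  is_series (fun n => Re (u n)) (Re l) /\ is_series (fun n => Im (u n)) (Im l).
Proof.
unfold is_series. split.
- intros H. split; apply filterlim_locally; intros eps;
    generalize (proj1 (filterlim_locally _ _) H eps); apply filter_imp;
    intros N HN;
    change (@sum_n C_NormedModule u N) with (@sum_n C_AbelianMonoid u N) in HN;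
    rewrite sum_n_C in HN; apply HN.
- intros [H1 H2]. apply (filterlim_locally (U := C_UniformSpace)). intros eps.
  generalize (filter_and _ _ (proj1 (filterlim_locally _ _) H1 eps)
               (proj1 (filterlim_locally _ _) H2 eps)).
  apply filter_imp. intros N [A B].
  change (@sum_n C_NormedModule u N) with (@sum_n C_AbelianMonoid u N).
  rewrite sum_n_C. split; assumption.
Qed.

Lemma CSeries_unique (u : nat -> C) (l : C) :
  @is_series C_AbsRing C_NormedModule u l -> CSeries u = l.
Proof.
intros H. apply is_series_C in H. destruct H as [H1 H2].
unfold CSeries. rewrite (is_series_unique _ _ H1), (is_series_unique _ _ H2).
now destruct l.
Qed.

Lemma CSeries_ext (u v : nat -> C) :
  (forall n, u n = v n) -> CSeries u = CSeries v.
Proof.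
intros H. unfold CSeries. f_equal; apply Series_ext; intros n; now rewrite H.
Qed.

Lemma im_le_Cmod (c : C) : Rabs (Im c) <= Cmod c.
Proof. eapply Rle_trans; [apply Rmax_r | apply (Rmax_Cmod c)]. Qed.

Lemma ex_series_le_R (a b : nat -> R) :
  (forall n, Rabs (a n) <= b n) -> ex_series b -> ex_series a.
Proof. intros H Hb. exact (@ex_series_le R_AbsRing R_CompleteNormedModule a b H Hb). Qed.

Lemma CSeries_correct (u : nat -> C) (b : nat -> R) :
  (forall n, Cmod (u n) <= b n) -> ex_series b ->
  @is_series C_AbsRing C_NormedModule u (CSeries u).
Proof.
intros H Hb. apply is_series_C. split; simpl; apply Series_correct;
  apply (ex_series_le_R _ b); auto; intros n; eapply Rle_trans; eauto.
- apply re_le_Cmod.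
- apply im_le_Cmod.
Qed.

Lemma is_series_C_plus (u v : nat -> C) (k l : C) :
  @is_series C_AbsRing C_NormedModule u k ->
  @is_series C_AbsRing C_NormedModule v l ->
  @is_series C_AbsRing C_NormedModule (fun n => (u n + v n)%C) (k + l)%C.
Proof. intros H1 H2. exact (is_series_plus _ _ _ _ H1 H2). Qed.

Lemma is_series_C_scal (c : C) (u : nat -> C) (k : C) :
  @is_series C_AbsRing C_NormedModule u k ->
  @is_series C_AbsRing C_NormedModule (fun n => (c * u n)%C) (c * k)%C.
Proof. intros H1. exact (is_series_scal (V := C_NormedModule) c _ _ H1). Qed.

Lemma Series_zero (u : nat -> R) : (forall n, u n = 0) -> Series u = 0.
Proof.
intros H. transitivity (Series (fun n => 0 * u n)).
- apply Series_ext. intros n. rewrite H. ring.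
- rewrite Series_scal_l. ring.
Qed.

Lemma sum_n_le_Series (a : nat -> R) N :
  (forall n, 0 <= a n) -> ex_series a -> sum_n a N <= Series a.
Proof.
intros H Ha. apply (is_lim_seq_incr_compare (sum_n a) (Series a)).
- apply (Series_correct _ Ha).
- intros n. rewrite sum_Sn. specialize (H (S n)). unfold plus; simpl. lra.
Qed.

Lemma term_le_sum_n (a : nat -> R) j :
  (forall n, 0 <= a n) -> a j <= sum_n a j.
Proof.
intros H. destruct j. rewrite sum_O; lra.
rewrite sum_Sn. unfold plus; simpl.
assert (0 <= sum_n a j); [|lra].
clear -H; induction j. rewrite sum_O; auto. rewrite sum_Sn; unfold plus; simpl.
specialize (H (S j)); lra.
Qed.

Lemma bounded_series (a : nat -> R) (M : R) :
  (forall n, 0 <= a n) -> (forall N, sum_n a N <= M) ->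
  ex_series a /\ Series a <= M.
Proof.
intros H HM.
assert (E : ex_series a).
{ destruct (ex_finite_lim_seq_incr (sum_n a) M) as [l Hl]; auto.
  - intros n. rewrite sum_Sn. specialize (H (S n)). unfold plus; simpl. lra.
  - exists l. exact Hl. }
split; auto.
assert (L := Series_correct _ E).
apply (is_lim_seq_le (sum_n a) (fun _ => M) (Series a) M); auto.
apply is_lim_seq_const.
Qed.

Lemma Series_nonneg (a : nat -> R) :
  (forall n, 0 <= a n) -> ex_series a -> 0 <= Series a.
Proof.
intros H Ha. eapply Rle_trans; [|apply (sum_n_le_Series a 0); auto].
rewrite sum_O; auto.
Qed.

Definition fin (s : R) (a : nat -> C) : Prop :=
  ex_series (fun n => weight s n * Cmod (a n) ^ 2).

Lemma weight_pos s n : 0 < weight s n.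
Proof. apply exp_pos. Qed.

Lemma weight_sq_nonneg s (a : nat -> C) n : 0 <= weight s n * Cmod (a n) ^ 2.
Proof. apply Rmult_le_pos. apply Rlt_le, weight_pos. apply pow2_ge_0. Qed.

Lemma fin_zero s : fin s (fun _ => RtoC 0).
Proof.
exists 0. apply is_series_ext with (fun _ => 0).
- intros n. rewrite Cmod_0. simpl; ring.
- apply filterlim_ext with (fun _ => 0).
  + intros N. induction N. now rewrite sum_O. rewrite sum_Sn, <- IHN.
    unfold plus; simpl; ring.
  + apply filterlim_const.
Qed.

Lemma fin_scal s c a : fin s a -> fin s (fun n => (c * a n)%C).
Proof.
intros H. apply ex_series_ext with (fun n => Cmod c ^ 2 * (weight s n * Cmod (a n) ^ 2)).
- intros n. rewrite Cmod_mult. simpl; ring.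
- apply (ex_series_scal (V := R_NormedModule) (Cmod c ^ 2)). exact H.
Qed.

Lemma fin_plus s a b : fin s a -> fin s b -> fin s (fun n => (a n + b n)%C).
Proof.
intros Ha Hb.
apply (ex_series_le_R _ (fun n => 2 * (weight s n * Cmod (a n) ^ 2 + weight s n * Cmod (b n) ^ 2))).
- intros n. rewrite Rabs_pos_eq by (apply (weight_sq_nonneg s (fun n => (a n + b n)%C))).
  rewrite <- Rmult_plus_distr_l.
  replace (2 * (weight s n * (Cmod (a n) ^ 2 + Cmod (b n) ^ 2)))
    with (weight s n * (2 * (Cmod (a n) ^ 2 + Cmod (b n) ^ 2))) by ring.
  apply Rmult_le_compat_l. apply Rlt_le, weight_pos.
  rewrite !Cmod_sq, re_plus, im_plus.
  assert (H1 := pow2_ge_0 (Re (a n) - Re (b n))).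
  assert (H2 := pow2_ge_0 (Im (a n) - Im (b n))). nra.
- apply (ex_series_scal (V := R_NormedModule) 2).
  apply (ex_series_plus (V := R_NormedModule) _ _ Ha Hb).
Qed.

Lemma fin_minus s a b : fin s a -> fin s b -> fin s (fun n => (a n - b n)%C).
Proof.
intros Ha Hb. apply (fin_scal s (Copp (RtoC 1))) in Hb.
generalize (fin_plus s _ _ Ha Hb). apply ex_series_ext. intros n.
replace (a n - b n)%C with (a n + Copp (RtoC 1) * b n)%C; auto.
ring.
Qed.

Lemma inner_term_le s (a b : nat -> C) n :
  Cmod (RtoC (weight s n) * (a n * Cconj (b n)))%C
  <= / 2 * (weight s n * Cmod (a n) ^ 2 + weight s n * Cmod (b n) ^ 2).
Proof.
rewrite !Cmod_mult, Cmod_conj, Cmod_R, Rabs_pos_eq by (apply Rlt_le, weight_pos).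
assert (H := weight_pos s n).
assert (0 <= weight s n * (Cmod (a n) - Cmod (b n)) ^ 2).
{ apply Rmult_le_pos; [lra | apply pow2_ge_0]. }
nra.
Qed.

Lemma inner_series s a b : fin s a -> fin s b ->
  @is_series C_AbsRing C_NormedModule
    (fun n => (RtoC (weight s n) * (a n * Cconj (b n)))%C)
    (CSeries (fun n => (RtoC (weight s n) * (a n * Cconj (b n)))%C)).
Proof.
intros Ha Hb. eapply CSeries_correct. intros n. apply inner_term_le.
apply (ex_series_scal (V := R_NormedModule) (/ 2)).
apply (ex_series_plus (V := R_NormedModule) _ _ Ha Hb).
Qed.

Lemma inner_self s a :
  CSeries (fun n => (RtoC (weight s n) * (a n * Cconj (a n)))%C)
  = RtoC (Series (fun n => weight s n * Cmod (a n) ^ 2)).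
Proof.
unfold CSeries. apply injective_projections; unfold RtoC, fst, snd.
- apply Series_ext. intros n. rewrite Cmod_sq. unfold Re, Im; simpl. ring.
- apply Series_zero. intros n. unfold Im; simpl. ring.
Qed.

Lemma Rpower_step_lim (s : R) :
  is_lim_seq (fun n => Rpower (INR (S (S n)) / INR (S n)) s) 1.
Proof.
assert (E : Rpower 1 s = 1).
{ unfold Rpower. rewrite ln_1, Rmult_0_r. apply exp_0. }
rewrite <- E.
apply (is_lim_seq_continuous (fun x => Rpower x s) (fun n => INR (S (S n)) / INR (S n)) 1).
- apply derivable_continuous_pt. exists (s * Rpower 1 (s - 1)).
  apply derivable_pt_lim_power. lra.
- apply is_lim_seq_ext with (fun n => 1 + / INR (S n)).
  + intros n. rewrite (S_INR (S n)).
    assert (INR (S n) <> 0) by (apply not_0_INR; discriminate).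
    field. auto.
  + replace (Finite 1) with (Finite (1 + 0)) by (f_equal; ring).
    apply is_lim_seq_plus'; [apply is_lim_seq_const|].
    replace (Finite 0) with (Rbar_inv p_infty) by reflexivity.
    apply is_lim_seq_inv; [|discriminate].
    apply (is_lim_seq_incr_1 INR). apply is_lim_seq_INR.
Qed.

Lemma geom_power_series (s r : R) : 0 <= r < 1 ->
  ex_series (fun n => Rpower (INR (S n)) s * r ^ n).
Proof.
intros [Hr0 Hr1].
set (q := Rmax r (/ 2)).
assert (Hq : 0 < q < 1).
{ unfold q. split. eapply Rlt_le_trans; [|apply Rmax_r]; lra. apply Rmax_lub_lt; lra. }
assert (Hrq : r <= q) by apply Rmax_l.
assert (P : forall n, 0 < Rpower (INR (S n)) s) by (intros; apply exp_pos).
assert (Q : forall n, 0 < q ^ n) by (intros; apply pow_lt; lra).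
apply (ex_series_le_R _ (fun n => Rabs (Rpower (INR (S n)) s * q ^ n))).
- intros n. rewrite !Rabs_mult. apply Rmult_le_compat_l. apply Rabs_pos.
  rewrite <- !RPow_abs, !Rabs_pos_eq by lra. apply pow_incr. lra.
- apply (ex_series_DAlembert _ q); [lra| |].
  + intros n. specialize (P n); specialize (Q n); nra.
  + apply is_lim_seq_ext with (fun n => q * Rpower (INR (S (S n)) / INR (S n)) s).
    * intros n.
      assert (I1 : 0 < INR (S n)) by (apply lt_0_INR; lia).
      assert (I2 : 0 < INR (S (S n))) by (apply lt_0_INR; lia).
      assert (E : Rpower (INR (S (S n)) / INR (S n)) s
                  = Rpower (INR (S (S n))) s / Rpower (INR (S n)) s).
      { apply Rmult_eq_reg_r with (Rpower (INR (S n)) s); [|specialize (P n); lra].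
        rewrite Rpower_mult_distr; auto.
        - unfold Rdiv. rewrite !Rmult_assoc, !Rinv_l, !Rmult_1_r; auto; try lra.
          specialize (P n); lra.
        - apply Rdiv_lt_0_compat; auto. }
      rewrite E. rewrite Rabs_pos_eq.
      -- change (q ^ S n) with (q * q ^ n).
         field. split; [specialize (Q n) | specialize (P n)]; lra.
      -- apply Rlt_le, Rdiv_lt_0_compat; apply Rmult_lt_0_compat; auto.
    * replace (Finite q) with (Rbar_mult q 1) by (simpl; f_equal; ring).
      apply is_lim_seq_scal_l. apply Rpower_step_lim.
Qed.

Lemma zeta_series (s : R) : s < -1 -> ex_series (fun n => Rpower (INR (S n)) s).
Proof.
intros Hs. set (p := - s - 1). assert (Hp : 0 < p) by (unfold p; lra).
assert (P : forall x y, 0 < Rpower x y) by (intros; apply exp_pos).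
assert (step : forall n, p * Rpower (INR (S (S n))) s
   <= Rpower (INR (S n)) (- p) - Rpower (INR (S (S n))) (- p)).
{ intros n. set (x := INR (S n)). set (y := INR (S (S n))).
  assert (I1 : 0 < x) by (apply lt_0_INR; lia).
  assert (I2 : y = x + 1) by (unfold y; rewrite S_INR; reflexivity).
  assert (Ly : Rpower y s = Rpower y (- p) * / y).
  { rewrite <- (Rpower_1 y) at 3 by lra. rewrite <- Rpower_Ropp, <- Rpower_plus.
    f_equal. unfold p; ring. }
  assert (Lx : Rpower x (- p) = Rpower y (- p) * exp (p * (ln y - ln x))).
  { unfold Rpower. rewrite <- exp_plus. f_equal. ring. }
  assert (L : / y <= ln y - ln x).
  { assert (A := exp_ineq1_le (ln x - ln y)).
    unfold Rminus in A. rewrite exp_plus, exp_Ropp, !exp_ln in A by lra.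
    assert (x * / y = 1 - / y) by (rewrite I2; field; lra). lra. }
  assert (A := exp_ineq1_le (p * (ln y - ln x))).
  rewrite Ly, Lx. specialize (P y (- p)).
  assert (p * / y <= exp (p * (ln y - ln x)) - 1) by nra.
  nra. }
apply (ex_series_incr_1 (fun n => Rpower (INR (S n)) s)).
destruct (bounded_series (fun n => Rpower (INR (S (S n))) s) (/ p * 1)) as [E _]; auto.
- intros n. apply Rlt_le, P.
- intros N.
  assert (B : p * sum_n (fun n => Rpower (INR (S (S n))) s) N
              <= 1 - Rpower (INR (S (S N))) (- p)).
  { induction N as [|N IH].
    - rewrite sum_O. specialize (step O). replace (Rpower (INR 1) (- p)) with 1 in step; auto.
      change (INR 1) with 1. unfold Rpower. now rewrite ln_1, Rmult_0_r, exp_0.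
    - rewrite sum_Sn. specialize (step (S N)). unfold plus.
      simpl in IH, step |- *. lra. }
  specialize (P (INR (S (S N))) (- p)).
  apply Rmult_le_reg_l with p; auto. rewrite <- Rmult_assoc, Rinv_r by lra. lra.
Qed.

Lemma diag_series (s : R) (z : C) : in_dom s z ->
  ex_series (fun n => Rpower (INR (S n)) s * Cmod (z ^ n)%C ^ 2).
Proof.
assert (Hz := Cmod_ge_0 z).
intros [[_ H]|[Hs H]].
- apply ex_series_ext with (fun n => Rpower (INR (S n)) s * (Cmod z ^ 2) ^ n).
  + intros n. rewrite Cmod_pow, <- !pow_mult. f_equal. f_equal. lia.
  + apply geom_power_series. split; nra.
- apply (ex_series_le_R _ (fun n => Rpower (INR (S n)) s)); [|now apply zeta_series].
  intros n. assert (P : 0 < Rpower (INR (S n)) s) by apply exp_pos.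
  rewrite Rabs_pos_eq by (apply Rmult_le_pos; [lra | apply pow2_ge_0]).
  rewrite <- (Rmult_1_r (Rpower (INR (S n)) s)) at 2.
  apply Rmult_le_compat_l. lra.
  rewrite Cmod_pow, <- (pow1 2). apply pow_incr.
  split. now apply pow_le. rewrite <- (pow1 n). apply pow_incr. lra.
Qed.

Lemma weight_inv s n : weight s n * Rpower (INR (S n)) s = 1.
Proof.
unfold weight, Rpower. rewrite <- exp_plus, <- exp_0. f_equal. ring.
Qed.

Lemma eval_term_le s a (z : C) n (N : R) : 0 < N ->
  Cmod (a n * z ^ n)%C <=
  / 2 * (/ N * (weight s n * Cmod (a n) ^ 2)
         + N * (Rpower (INR (S n)) s * Cmod (z ^ n)%C ^ 2)).
Proof.
intros HN. rewrite Cmod_mult.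
assert (W := weight_pos s n). assert (E := weight_inv s n).
set (w := weight s n) in *. set (v := Rpower (INR (S n)) s) in *.
set (x := Cmod (a n)). set (y := Cmod (z ^ n)%C).
assert (Hv : 0 < v) by apply exp_pos.
assert (I : 0 < / N) by now apply Rinv_0_lt_compat.
assert (NI : N * / N = 1) by (apply Rinv_r; lra).
assert (S1 : 0 <= v * N * (w * / N * x - y) ^ 2).
{ apply Rmult_le_pos; [nra | apply pow2_ge_0]. }
assert (S2 : v * N * (w * / N * x - y) ^ 2 =
  (w * v) * (N * / N) * (/ N * (w * x ^ 2)) - 2 * ((w * v) * (N * / N)) * (x * y)
  + N * (v * y ^ 2)) by ring.
rewrite S2, E, NI in S1. lra.
Qed.

Lemma eval_series s a z : fin s a -> in_dom s z ->
  @is_series C_AbsRing C_NormedModule (fun n => (a n * z ^ n)%C)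
    (CSeries (fun n => (a n * z ^ n)%C)).
Proof.
intros Ha Hz. eapply CSeries_correct.
- intros n. apply (eval_term_le s a z n 1). lra.
- apply (ex_series_scal (V := R_NormedModule) (/ 2)).
  apply (ex_series_plus (V := R_NormedModule)).
  + apply (ex_series_scal (V := R_NormedModule) (/ 1)). exact Ha.
  + apply (ex_series_scal (V := R_NormedModule) 1). now apply diag_series.
Qed.

Lemma real_coef_zero (d : nat -> R) :
  (forall x, Rabs x < 1 -> is_series (fun n => d n * x ^ n) 0) -> forall n, d n = 0.
Proof.
intros H n.
assert (CV : Rbar_lt 0 (CV_radius d)).
{ apply Rbar_lt_le_trans with (/ 2); [simpl; lra|].
  apply Rbar_not_lt_le. intros L.
  apply (CV_disk_outside d (/ 2)).
  - rewrite Rabs_pos_eq by lra. exact L.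
  - apply (ex_series_lim_0 (fun n => d n * (/ 2) ^ n)). exists 0. apply H.
    rewrite Rabs_pos_eq; lra. }
apply (PSeries_ext_recip d (fun _ => 0) n); auto.
- rewrite CV_radius_const_0. exact I.
- exists (mkposreal 1 Rlt_0_1). intros x Hx.
  rewrite PSeries_const_0. apply is_series_unique. apply H.
  change (Rabs (x + - 0) < 1) in Hx. now rewrite Ropp_0, Rplus_0_r in Hx.
Qed.

Lemma has_coef_unique s f a b : has_coef s f a -> has_coef s f b -> a = b.
Proof.
intros [_ Ha] [_ Hb].
assert (D : forall x : R, Rabs x < 1 ->
  @is_series C_AbsRing C_NormedModule
    (fun n => (RtoC (x ^ n) * (a n - b n))%C) (RtoC 0)).
{ intros x Hx.
  assert (Hd : in_dom s (RtoC x)).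
  { unfold in_dom. rewrite Cmod_R. destruct (Rle_lt_dec (-1) s); [left|right]; lra. }
  specialize (Ha (exist _ _ Hd)). specialize (Hb (exist _ _ Hd)). unfold pt in *; simpl in *.
  apply (is_series_C_scal (Copp (RtoC 1))) in Hb.
  generalize (is_series_C_plus _ _ _ _ Ha Hb).
  replace (f (exist _ _ Hd) + Copp (RtoC 1) * f (exist _ _ Hd))%C with (RtoC 0)
    by (ring).
  apply is_series_ext. intros n. rewrite RtoC_pow. simpl.
  ring. }
assert (Z : forall n, Re (a n - b n)%C = 0 /\ Im (a n - b n)%C = 0).
{ intros n. split; [apply (real_coef_zero (fun n => Re (a n - b n)%C))
                   |apply (real_coef_zero (fun n => Im (a n - b n)%C))];
  intros x Hx; specialize (D x Hx); apply is_series_C in D;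
  [destruct D as [D _] | destruct D as [_ D]]; revert D; apply is_series_ext;
  intros k; unfold Re, Im; simpl; ring. }
apply functional_extensionality. intros n. destruct (Z n) as [Z1 Z2].
unfold Re, Im in *. simpl in *.
apply injective_projections; lra.
Qed.

Lemma coef_eq s f a : has_coef s f a -> coef s f = a.
Proof.
intros H. apply (has_coef_unique s f); auto.
unfold coef. apply epsilon_spec. now exists a.
Qed.

Lemma coef_spec s f : Hs_mem s f -> has_coef s f (coef s f).
Proof. intros [a H]. now rewrite (coef_eq _ _ _ H). Qed.

Lemma has_coef_plus s f g a b : has_coef s f a -> has_coef s g b ->
  has_coef s (fun z => (f z + g z)%C) (fun n => (a n + b n)%C).
Proof.
intros [Fa Ha] [Fb Hb]. split. now apply fin_plus.
intros z. generalize (is_series_C_plus _ _ _ _ (Ha z) (Hb z)).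
apply is_series_ext. intros n. simpl. ring.
Qed.

Lemma has_coef_scal s c f a : has_coef s f a ->
  has_coef s (fun z => (c * f z)%C) (fun n => (c * a n)%C).
Proof.
intros [Fa Ha]. split. now apply fin_scal.
intros z. generalize (is_series_C_scal c _ _ (Ha z)).
apply is_series_ext. intros n. simpl. ring.
Qed.

Lemma has_coef_minus s f g a b : has_coef s f a -> has_coef s g b ->
  has_coef s (fun z => (f z - g z)%C) (fun n => (a n - b n)%C).
Proof.
intros Ha Hb. apply (has_coef_scal s (Copp (RtoC 1))) in Hb.
generalize (has_coef_plus _ _ _ _ _ Ha Hb).
replace (fun z => (f z + Copp (RtoC 1) * g z)%C) with (fun z => (f z - g z)%C).
replace (fun n => (a n + Copp (RtoC 1) * b n)%C) with (fun n => (a n - b n)%C). auto.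
all: apply functional_extensionality; intros; ring.
Qed.

Lemma has_coef_CSeries s a : fin s a ->
  has_coef s (fun z => CSeries (fun n => (a n * pt z ^ n)%C)) a.
Proof.
intros Ha. split; auto. intros [z Hz]. now apply (eval_series s).
Qed.

Lemma Hs_inner_eq s f g a b : has_coef s f a -> has_coef s g b ->
  Hs_inner s f g = CSeries (fun n => (RtoC (weight s n) * (a n * Cconj (b n)))%C).
Proof.
intros Ha Hb. unfold Hs_inner. now rewrite (coef_eq _ _ _ Ha), (coef_eq _ _ _ Hb).
Qed.

Lemma Hs_norm_eq s f a : has_coef s f a ->
  norm_of (Hs_inner s) f = sqrt (Series (fun n => weight s n * Cmod (a n) ^ 2)).
Proof.
intros Ha. unfold norm_of. rewrite (Hs_inner_eq _ _ _ _ _ Ha Ha), inner_self.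
reflexivity.
Qed.

Lemma Hs_zero s : Hs_mem s (fun _ => RtoC 0).
Proof.
exists (fun _ => RtoC 0). split. apply fin_zero.
intros [z Hz]. generalize (eval_series s _ z (fin_zero s) Hz).
replace (CSeries (fun n => (RtoC 0 * z ^ n)%C)) with (RtoC 0); auto.
symmetry. rewrite (CSeries_ext _ (fun n => (RtoC (weight s n) * (RtoC 0 * Cconj (RtoC 0)))%C)).
- rewrite inner_self with (a := fun _ => RtoC 0). f_equal.
  apply Series_zero. intros n. rewrite Cmod_0. simpl. ring.
- intros n. ring.
Qed.

Lemma Hs_plus s f g : Hs_mem s f -> Hs_mem s g -> Hs_mem s (fun x => (f x + g x)%C).
Proof. intros [a Ha] [b Hb]. eexists. apply has_coef_plus; eauto. Qed.

Lemma Hs_scal s c f : Hs_mem s f -> Hs_mem s (fun x => (c * f x)%C).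
Proof. intros [a Ha]. eexists. apply has_coef_scal; eauto. Qed.

Lemma Hs_inner_plus s f g h : Hs_mem s f -> Hs_mem s g -> Hs_mem s h ->
  Hs_inner s (fun x => (f x + g x)%C) h = (Hs_inner s f h + Hs_inner s g h)%C.
Proof.
intros [a Ha] [b Hb] [c Hc].
rewrite (Hs_inner_eq _ _ _ _ _ (has_coef_plus _ _ _ _ _ Ha Hb) Hc).
rewrite (Hs_inner_eq _ _ _ _ _ Ha Hc), (Hs_inner_eq _ _ _ _ _ Hb Hc).
apply CSeries_unique.
generalize (is_series_C_plus _ _ _ _ (inner_series s a c (proj1 Ha) (proj1 Hc))
   (inner_series s b c (proj1 Hb) (proj1 Hc))).
apply is_series_ext. intros n. simpl. ring.
Qed.

Lemma Hs_inner_scal s c f g : Hs_mem s f -> Hs_mem s g ->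
  Hs_inner s (fun x => (c * f x)%C) g = (c * Hs_inner s f g)%C.
Proof.
intros [a Ha] [b Hb].
rewrite (Hs_inner_eq _ _ _ _ _ (has_coef_scal _ c _ _ Ha) Hb), (Hs_inner_eq _ _ _ _ _ Ha Hb).
apply CSeries_unique.
generalize (is_series_C_scal c _ _ (inner_series s a b (proj1 Ha) (proj1 Hb))).
apply is_series_ext. intros n. simpl. ring.
Qed.

Lemma Hs_inner_conj s f g : Hs_mem s f -> Hs_mem s g ->
  Hs_inner s g f = Cconj (Hs_inner s f g).
Proof.
intros _ _. unfold Hs_inner, CSeries, Cconj. simpl. f_equal.
- apply Series_ext. intros n. unfold Re, Im; simpl. ring.
- rewrite <- Series_opp. apply Series_ext. intros n. unfold Re, Im; simpl. ring.
Qed.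

Lemma Hs_inner_pos s f : Hs_mem s f -> 0 <= Re (Hs_inner s f f).
Proof.
intros [a Ha]. rewrite (Hs_inner_eq _ _ _ _ _ Ha Ha), inner_self.
simpl. apply Series_nonneg. apply weight_sq_nonneg. apply Ha.
Qed.

Lemma weighted_term_le s a j : fin s a ->
  weight s j * Cmod (a j) ^ 2 <= Series (fun n => weight s n * Cmod (a n) ^ 2).
Proof.
intros Ha. eapply Rle_trans.
apply (term_le_sum_n (fun n => weight s n * Cmod (a n) ^ 2)). apply weight_sq_nonneg.
apply sum_n_le_Series. apply weight_sq_nonneg. exact Ha.
Qed.

Lemma norm_zero_coef s a : fin s a ->
  Series (fun n => weight s n * Cmod (a n) ^ 2) = 0 -> a = (fun _ => RtoC 0).
Proof.
intros Ha H. apply functional_extensionality. intros j. apply Cmod_eq_0.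
assert (T := weighted_term_le s a j Ha). rewrite H in T.
assert (W := weight_pos s j). assert (P := pow2_ge_0 (Cmod (a j))).
assert (Q := Cmod_ge_0 (a j)).
assert (Cmod (a j) ^ 2 = 0) by nra.
nra.
Qed.

Lemma coef_zero s f : has_coef s f (fun _ => RtoC 0) -> forall z, f z = RtoC 0.
Proof.
intros [_ H] z. specialize (H z). apply CSeries_unique in H. rewrite <- H.
unfold CSeries; apply injective_projections; unfold RtoC, fst, snd;
apply Series_zero; intros n; unfold Re, Im; simpl; ring.
Qed.

Lemma Hs_inner_definite s f : Hs_mem s f -> Hs_inner s f f = RtoC 0 ->
  forall x, f x = RtoC 0.
Proof.
intros [a Ha] H. rewrite (Hs_inner_eq _ _ _ _ _ Ha Ha), inner_self in H.
apply RtoC_inj in H.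
apply coef_zero. rewrite <- (norm_zero_coef s a); auto. apply Ha.
Qed.

Lemma Hs_eval_bounded s (x : dom s) : exists M, forall f, Hs_mem s f ->
  Cmod (f x) <= M * norm_of (Hs_inner s) f.
Proof.
destruct x as [z Hz].
set (D := Series (fun n => Rpower (INR (S n)) s * Cmod (z ^ n)%C ^ 2)).
exists (1 + D). intros f [a Ha].
rewrite (Hs_norm_eq s f a Ha).
set (A := Series (fun n => weight s n * Cmod (a n) ^ 2)).
assert (PA : 0 <= A) by (apply Series_nonneg; [apply weight_sq_nonneg | apply Ha]).
destruct (Req_dec A 0) as [Z|NZ].
{ assert (E := norm_zero_coef s a (proj1 Ha) Z). subst a.
  rewrite (coef_zero s f Ha), Cmod_0, Z, sqrt_0. lra. }
set (N := sqrt A). assert (HN : 0 < N) by (apply sqrt_lt_R0; lra).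
assert (NN : N * N = A) by now apply sqrt_sqrt.
destruct Ha as [Fa Ha]. specialize (Ha (exist _ z Hz)). unfold pt in Ha; simpl in Ha.
apply is_series_C in Ha. destruct Ha as [H1 H2].
set (t := fun n => / 2 * (/ N * (weight s n * Cmod (a n) ^ 2)
         + N * (Rpower (INR (S n)) s * Cmod (z ^ n)%C ^ 2))).
assert (T1 : is_series t (/ 2 * (/ N * A + N * D))).
{ apply (is_series_scal (V := R_NormedModule) (/ 2)).
  apply (is_series_plus (V := R_NormedModule)).
  - apply (is_series_scal (V := R_NormedModule) (/ N)). now apply Series_correct.
  - apply (is_series_scal (V := R_NormedModule) N). apply Series_correct.
    now apply diag_series. }
assert (T2 : / 2 * (/ N * A + N * D) = / 2 * (1 + D) * N).
{ rewrite <- NN. field. lra. }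
rewrite T2 in T1.
assert (B : forall u l, (forall n, Rabs (u n) <= t n) -> is_series u l ->
            Rabs l <= / 2 * (1 + D) * N).
{ intros u l Hu Hl. rewrite <- (is_series_unique _ _ T1), <- (is_series_unique _ _ Hl).
  assert (ex_series t) by (eexists; eauto).
  eapply Rle_trans.
  - apply Series_Rabs. apply (ex_series_le_R _ t); auto. intros n. now rewrite Rabs_Rabsolu.
  - apply Series_le; auto. intros n. split; [apply Rabs_pos | auto]. }
assert (B1 : Rabs (Re (f (exist _ z Hz))) <= / 2 * (1 + D) * N).
{ eapply B; [|apply H1]. intros n. eapply Rle_trans; [apply re_le_Cmod|].
  now apply eval_term_le. }
assert (B2 : Rabs (Im (f (exist _ z Hz))) <= / 2 * (1 + D) * N).
{ eapply B; [|apply H2]. intros n. eapply Rle_trans; [apply im_le_Cmod|].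
  now apply eval_term_le. }
set (c := f (exist _ z Hz)) in *.
replace c with (RtoC (Re c) + Ci * RtoC (Im c))%C.
- eapply Rle_trans; [apply Cmod_triangle|].
  rewrite Cmod_mult, Cmod_Ci, !Cmod_R. lra.
- apply injective_projections; unfold Re, Im; simpl; ring.
Qed.

Lemma Hs_complete s (u : nat -> dom s -> C) :
  (forall n, Hs_mem s (u n)) ->
  (forall eps, 0 < eps -> exists N, forall m n, (N <= m)%nat -> (N <= n)%nat ->
     norm_of (Hs_inner s) (fun x => (u m x - u n x)%C) < eps) ->
  exists f, Hs_mem s f /\
    forall eps, 0 < eps -> exists N, forall n, (N <= n)%nat ->
      norm_of (Hs_inner s) (fun x => (u n x - f x)%C) < eps.
Proof.
intros Hu HC. set (A := fun k => coef s (u k)).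
assert (HA : forall k, has_coef s (u k) (A k)) by (intros; now apply coef_spec).
assert (FA : forall m n, fin s (fun j => (A m j - A n j)%C)).
{ intros m n. apply fin_minus; apply HA. }
assert (HC2 : forall eps, 0 < eps -> exists N, forall m n, (N <= m)%nat -> (N <= n)%nat ->
   Series (fun j => weight s j * Cmod (A m j - A n j)%C ^ 2) < eps ^ 2).
{ intros eps He. destruct (HC eps He) as [N HN]. exists N. intros m n Hm Hn.
  specialize (HN m n Hm Hn).
  rewrite (Hs_norm_eq _ _ _ (has_coef_minus _ _ _ _ _ (HA m) (HA n))) in HN.
  set (X := Series _) in *.
  assert (PX : 0 <= X) by (apply Series_nonneg;
    [apply (weight_sq_nonneg s (fun j => (A m j - A n j)%C)) | apply FA]).
  assert (sqrt X * sqrt X = X) by now apply sqrt_sqrt.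
  assert (0 <= sqrt X) by apply sqrt_pos. nra. }
assert (pw : forall j eps, 0 < eps -> exists N, forall m n, (N <= m)%nat -> (N <= n)%nat ->
   Cmod (A m j - A n j)%C < eps).
{ intros j eps He. assert (W := weight_pos s j).
  assert (SW : 0 < sqrt (weight s j)) by now apply sqrt_lt_R0.
  assert (SS : sqrt (weight s j) * sqrt (weight s j) = weight s j) by (apply sqrt_sqrt; lra).
  destruct (HC2 (sqrt (weight s j) * eps)) as [N HN].
  { now apply Rmult_lt_0_compat. }
  exists N. intros m n Hm Hn. specialize (HN m n Hm Hn).
  assert (T := weighted_term_le s _ j (FA m n)). simpl in T.
  assert (Q := Cmod_ge_0 (A m j - A n j)%C).
  apply Rnot_le_lt. intros L.
  assert (L2 : eps ^ 2 <= Cmod (A m j - A n j)%C ^ 2) by (apply pow_incr; lra).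
  apply (Rmult_le_compat_l (weight s j)) in L2; [|lra].
  replace ((sqrt (weight s j) * eps) ^ 2) with (weight s j * eps ^ 2) in HN
    by (rewrite <- SS at 1; ring).
  simpl in *. lra. }
assert (LR : forall j, exists l : R, is_lim_seq (fun k => Re (A k j)) l).
{ intros j. apply ex_lim_seq_cauchy_corr. intros eps.
  destruct (pw j eps (cond_pos eps)) as [N HN]. exists N. intros n m Hn Hm.
  eapply Rle_lt_trans; [|apply (HN n m Hn Hm)].
  eapply Rle_trans; [|apply re_le_Cmod]. apply Req_le. reflexivity. }
assert (LI : forall j, exists l : R, is_lim_seq (fun k => Im (A k j)) l).
{ intros j. apply ex_lim_seq_cauchy_corr. intros eps.
  destruct (pw j eps (cond_pos eps)) as [N HN]. exists N. intros n m Hn Hm.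
  eapply Rle_lt_trans; [|apply (HN n m Hn Hm)].
  eapply Rle_trans; [|apply im_le_Cmod]. apply Req_le. reflexivity. }
set (B := fun j => (real (Lim_seq (fun k => Re (A k j))), real (Lim_seq (fun k => Im (A k j)))) : C).
assert (BR : forall j, is_lim_seq (fun k => Re (A k j)) (Re (B j))).
{ intros j. destruct (LR j) as [l Hl]. unfold B, Re at 2; simpl.
  now rewrite (is_lim_seq_unique _ _ Hl). }
assert (BI : forall j, is_lim_seq (fun k => Im (A k j)) (Im (B j))).
{ intros j. destruct (LI j) as [l Hl]. unfold B, Im at 2; simpl.
  now rewrite (is_lim_seq_unique _ _ Hl). }
assert (LS : forall m N, is_lim_seq
   (fun n => sum_n (fun j => weight s j * Cmod (A m j - A n j)%C ^ 2) N)
   (sum_n (fun j => weight s j * Cmod (A m j - B j)%C ^ 2) N)).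
{ intros m N.
  assert (LT : forall j, is_lim_seq (fun n => weight s j * Cmod (A m j - A n j)%C ^ 2)
     (weight s j * Cmod (A m j - B j)%C ^ 2)).
  { intros j. rewrite Cmod_sq.
    apply is_lim_seq_ext with (fun n => weight s j *
      ((Re (A m j) - Re (A n j)) * (Re (A m j) - Re (A n j))
       + (Im (A m j) - Im (A n j)) * (Im (A m j) - Im (A n j)))).
    - intros n. rewrite Cmod_sq. unfold Re, Im; simpl. ring.
    - replace (Re (A m j - B j)%C ^ 2 + Im (A m j - B j)%C ^ 2) with
      ((Re (A m j) - Re (B j)) * (Re (A m j) - Re (B j))
       + (Im (A m j) - Im (B j)) * (Im (A m j) - Im (B j)))
        by (unfold Re, Im; simpl; ring).
      apply is_lim_seq_mult'; [apply is_lim_seq_const|].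
      apply is_lim_seq_plus'; apply is_lim_seq_mult'; apply is_lim_seq_minus'; auto;
        apply is_lim_seq_const. }
  induction N as [|N IH].
  - apply is_lim_seq_ext with (fun n => weight s 0 * Cmod (A m O - A n O)%C ^ 2).
    intros n; now rewrite sum_O. rewrite sum_O. apply LT.
  - apply is_lim_seq_ext with (fun n =>
      sum_n (fun j => weight s j * Cmod (A m j - A n j)%C ^ 2) N
      + weight s (S N) * Cmod (A m (S N) - A n (S N))%C ^ 2).
    intros n; now rewrite sum_Sn. rewrite sum_Sn. now apply is_lim_seq_plus'. }
assert (key : forall eps, 0 < eps -> exists N, forall m, (N <= m)%nat ->
   fin s (fun j => (A m j - B j)%C) /\
   Series (fun j => weight s j * Cmod (A m j - B j)%C ^ 2) <= eps ^ 2).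
{ intros eps He. destruct (HC2 eps He) as [N HN]. exists N. intros m Hm.
  apply bounded_series. apply (weight_sq_nonneg s (fun j => (A m j - B j)%C)).
  intros K.
  apply (is_lim_seq_le_loc
     (fun n => sum_n (fun j => weight s j * Cmod (A m j - A n j)%C ^ 2) K) (fun _ => eps ^ 2)
     (sum_n (fun j => weight s j * Cmod (A m j - B j)%C ^ 2) K) (eps ^ 2)); auto.
  - exists N. intros n Hn. apply Rlt_le. eapply Rle_lt_trans; [|apply (HN m n Hm Hn)].
    apply sum_n_le_Series. apply (weight_sq_nonneg s (fun j => (A m j - A n j)%C)). apply FA.
  - apply is_lim_seq_const. }
assert (FB : fin s B).
{ destruct (key 1 Rlt_0_1) as [N HN]. destruct (HN N (Nat.le_refl N)) as [F _].
  generalize (fin_minus s _ _ (proj1 (HA N)) F).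
  apply ex_series_ext. intros j. f_equal. f_equal. f_equal. ring. }
assert (HB := has_coef_CSeries s B FB).
eexists. split. exists B. apply HB.
intros eps He. destruct (key (eps / 2)) as [N HN]; [lra|].
exists N. intros n Hn. destruct (HN n Hn) as [_ L].
rewrite (Hs_norm_eq _ _ _ (has_coef_minus _ _ _ _ _ (HA n) HB)).
eapply Rle_lt_trans; [apply sqrt_le_1_alt, L|].
rewrite sqrt_pow2; lra.
Qed.

Definition Hs (s : R) : HilbertFunctionSpace (dom s) := {|
  mem := Hs_mem s;
  inner := Hs_inner s;
  mem_zero := Hs_zero s;
  mem_plus := Hs_plus s;
  mem_scal := Hs_scal s;
  inner_plus := Hs_inner_plus s;
  inner_scal := Hs_inner_scal s;
  inner_conj := Hs_inner_conj s;
  inner_pos := Hs_inner_pos s;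
  inner_definite := Hs_inner_definite s;
  complete := Hs_complete s;
  eval_bounded := Hs_eval_bounded s
|}.

Lemma Hs_reproducing_kernel (s : R) : reproducing_kernel (Hs s) (Hs_kernel s).
Proof.
intros [w Hw]. set (k := fun n => (RtoC (Rpower (INR (S n)) s) * Cconj w ^ n)%C).
assert (Fk : fin s k).
{ generalize (diag_series s w Hw). apply ex_series_ext. intros n. unfold k.
  change (Rpower (INR (S n)) s * Cmod (w ^ n)%C ^ 2 =
          weight s n * Cmod (RtoC (Rpower (INR (S n)) s) * Cconj w ^ n)%C ^ 2 :> R).
  rewrite Cmod_mult, Cmod_R, !Cmod_pow, Cmod_conj, Rabs_pos_eq by (apply Rlt_le, exp_pos).
  transitivity ((weight s n * Rpower (INR (S n)) s)
                * (Rpower (INR (S n)) s * (Cmod w ^ n) ^ 2)); [rewrite weight_inv|]; ring. }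
assert (Hk : has_coef s (fun z => Hs_kernel s z (exist _ w Hw)) k).
{ generalize (has_coef_CSeries s k Fk).
  replace (fun z : dom s => CSeries (fun n => (k n * pt z ^ n)%C))
    with (fun z => Hs_kernel s z (exist _ w Hw)); auto.
  apply functional_extensionality. intros z. unfold Hs_kernel. apply CSeries_ext.
  intros n. unfold k. simpl. rewrite Cpow_mult_l. ring. }
split. { exists k. exact Hk. }
intros f [a Ha]. refine (eq_trans _ (eq_sym (Hs_inner_eq _ _ _ _ _ Ha Hk))).
destruct Ha as [_ Ha]. specialize (Ha (exist _ w Hw)).
rewrite <- (CSeries_unique _ _ Ha). apply CSeries_ext. intros n.
unfold k, pt, proj1_sig. rewrite Cmult_conj, Cpow_conj, Cconj_conj.
replace (Cconj (RtoC (Rpower (INR (S n)) s))) with (RtoC (Rpower (INR (S n)) s))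
  by (apply injective_projections; simpl; ring).
transitivity ((RtoC (weight s n) * RtoC (Rpower (INR (S n)) s)) * (a n * w ^ n))%C; [|ring].
rewrite <- RtoC_mult, weight_inv. ring.
Qed.

Definition Bergman : HilbertFunctionSpace (dom 1) := Hs 1.

(* Main.v *)
Require Import Defs.
From Stdlib Require Import Reals Lra Lia ClassicalEpsilon FunctionalExtensionality.
From Coquelicot Require Import Coquelicot.
Open Scope R_scope.

(** Suppose that [W f = lambda (f o phi)] is an invertible weighted composition
    operator from the Bergman space to [H_s] with [s <= 0], and let [f n] be the
    function with [W (f n) = z^n]. The contradiction comes from the normalised
    monomials [u n = (n+1)^(s/2) z^n], an orthonormal basis of [H_s], and their
    inverse images [g n = (n+1)^(s/2) f n].

    By the bounded inverse theorem ([wco_bounded_below]), evaluation of [W^-1 h]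
    at a point [w] of the disc is a bounded functional of [h], so by Bessel's
    inequality [g n w] tends to [0] for every [w] ([inverse_monomials_to_zero]).

    The operator [W^-1 M_z W] commutes with multiplication by the variable, and
    is therefore the multiplication by a function [tau]
    ([conjugate_of_mul_z]). Hence [f n = tau^n (f 0)]. Since
    [(n+1)^s |tau w|^(2n) |f 0 w|^2] tends to [0], either [f 0 w = 0] or
    [|tau w| <= 1]; in both cases, as [s <= 0], [|g n w| <= |f 0 w|].

    So the functions [g n] are dominated by the member [f 0] of the Bergman
    space and tend to [0] pointwise. The Bergman norm is an integral of the
    squared modulus over the disc, so dominated convergence gives that the norm
    of [g n] tends to [0] ([Bergman_dominated_convergence]). This contradicts the
    boundedness of [W], since [W (g n) = u n] has norm [1].

    The domination argument is carried out on Taylor coefficients: the integral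
    over a circle is replaced by means over roots of unity, computed by the
    discrete Parseval identity ([mean_sq_approx]), and the radial integral is
    that of a power series in the squared radius ([outer_domination]). *)

(** * Finite sums and series *)

Notation csum := (@sum_n C_AbelianMonoid).

Lemma csum_O (u : nat -> C) : csum u O = u O.
Proof. apply (@sum_O C_AbelianMonoid). Qed.

Lemma csum_S (u : nat -> C) n : csum u (S n) = (csum u n + u (S n))%C.
Proof. apply (@sum_Sn C_AbelianMonoid). Qed.

Lemma sum_n_S (u : nat -> R) n : sum_n u (S n) = sum_n u n + u (S n).
Proof. rewrite sum_Sn. reflexivity. Qed.

Lemma is_series_finite (u : nat -> R) N :
  (forall n, (N < n)%nat -> u n = 0) -> is_series u (sum_n u N).
Proof.
intros H.
change (is_lim_seq (sum_n u) (sum_n u N)).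
apply (is_lim_seq_ext_loc (fun _ => sum_n u N)); [|apply is_lim_seq_const].
exists N. intros n Hn. induction Hn as [|n Hn IH]; auto.
rewrite sum_n_S, <- IH, H by lia. symmetry. apply Rplus_0_r.
Qed.

Lemma is_series_single (u : nat -> R) n : (forall k, k <> n -> u k = 0) -> is_series u (u n).
Proof.
intros H. replace (u n) with (sum_n u n); [apply is_series_finite; intros; apply H; lia|].
assert (Z : forall m, (m < n)%nat -> sum_n u m = 0).
{ induction m as [|m IH]; intros Hm.
  - rewrite sum_O. apply H. lia.
  - rewrite sum_n_S, IH, H by lia. apply Rplus_0_r. }
destruct n as [|n]; [apply sum_O|]. rewrite sum_n_S, Z by lia. apply Rplus_0_l.
Qed.

Lemma csum_scal (c : C) (u : nat -> C) N : csum (fun k => (c * u k)%C) N = (c * csum u N)%C.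
Proof. exact (sum_n_mult_l (K := C_Ring) c u N). Qed.

Lemma rsum_ext (u v : nat -> R) N : (forall k, u k = v k :> R) -> sum_n u N = sum_n v N.
Proof. apply sum_n_ext. Qed.

Lemma csum_plus (u v : nat -> C) N : csum (fun k => (u k + v k)%C) N = (csum u N + csum v N)%C.
Proof. exact (sum_n_plus (G := C_AbelianMonoid) u v N). Qed.

Lemma csum_ext (u v : nat -> C) N : (forall k, u k = v k :> C) -> csum u N = csum v N.
Proof. apply sum_n_ext. Qed.

Lemma Re_csum (u : nat -> C) N : Re (csum u N) = sum_n (fun k => Re (u k)) N.
Proof. rewrite sum_n_C. reflexivity. Qed.

Lemma sum_n_scal (c : R) (u : nat -> R) N : sum_n (fun k => c * u k) N = c * sum_n u N.
Proof. exact (sum_n_mult_l (K := R_Ring) c u N). Qed.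

Lemma sum_n_add (u v : nat -> R) N : sum_n (fun k => u k + v k) N = sum_n u N + sum_n v N.
Proof. exact (sum_n_plus (G := R_AbelianMonoid) u v N). Qed.

Lemma sum_n_mono (u v : nat -> R) N :
  (forall k, (k <= N)%nat -> u k <= v k) -> sum_n u N <= sum_n v N.
Proof.
induction N as [|N IH]; intros H.
- rewrite !sum_O. apply H. lia.
- rewrite !sum_n_S. assert (A := H (S N) (Nat.le_refl _)).
  assert (B : sum_n u N <= sum_n v N) by (apply IH; intros; apply H; lia). lra.
Qed.

Lemma sum_n_cst (c : R) N : sum_n (fun _ => c) N = INR (S N) * c.
Proof. apply sum_n_const. Qed.

Lemma dependent_choice {T : Type} (P : nat -> T -> Prop) (Q : nat -> T -> T -> Prop) (x0 : T) :
  P O x0 -> (forall n x, P n x -> exists y, P (S n) y /\ Q n x y) ->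
  exists u : nat -> T, u O = x0 /\ (forall n, P n (u n)) /\ forall n, Q n (u n) (u (S n)).
Proof.
intros H0 Hs.
set (u := fix u n := match n with
  | O => x0
  | S k => epsilon (inhabits x0) (fun y => P (S k) y /\ Q k (u k) y) end).
assert (HP : forall n, P n (u n)).
{ induction n as [|n IH]; auto.
  exact (proj1 (epsilon_spec (inhabits x0) _ (Hs n (u n) IH))). }
exists u. split; [reflexivity | split; auto]. intros n.
exact (proj2 (epsilon_spec (inhabits x0) _ (Hs n (u n) (HP n)))).
Qed.

(** * The norm of a Hilbert function space *)

Section Norm.
Context {X : Type} (H : HilbertFunctionSpace X).

Lemma mem_minus f g : mem H f -> mem H g -> mem H (fun x => (f x - g x)%C).
Proof.
intros Hf Hg.
replace (fun x => (f x - g x)%C) with (fun x => (f x + Copp (RtoC 1) * g x)%C)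
  by (apply functional_extensionality; intros x; ring).
apply mem_plus; auto. now apply mem_scal.
Qed.

Lemma hnorm_nonneg f : 0 <= hnorm H f.
Proof. apply sqrt_pos. Qed.

Lemma hnorm_sq f : mem H f -> hnorm H f ^ 2 = Re (inner H f f).
Proof. intros Hf. apply pow2_sqrt, (inner_pos _ H), Hf. Qed.

Lemma hnorm_scal c f : mem H f -> hnorm H (fun x => (c * f x)%C) = Cmod c * hnorm H f.
Proof.
intros Hf. assert (Hc := mem_scal _ H c f Hf).
apply Rsqr_inj; [apply hnorm_nonneg | apply Rmult_le_pos; [apply Cmod_ge_0 | apply hnorm_nonneg] |].
rewrite !Rsqr_pow2, Rpow_mult_distr, !hnorm_sq by auto.
rewrite (inner_scal _ H c f _ Hf Hc), (inner_conj _ H _ _ Hc Hf), (inner_scal _ H c f f Hf Hf).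
rewrite Cmod_sq. unfold Re, Im; simpl. ring.
Qed.

Lemma hnorm_eq_0 f : mem H f -> hnorm H f = 0 -> f = (fun _ => RtoC 0).
Proof.
intros Hf H0. apply functional_extensionality. apply (inner_definite _ H); auto.
assert (E := hnorm_sq f Hf). rewrite H0 in E.
assert (I := f_equal Im (inner_conj _ H f f Hf Hf)).
apply injective_projections; unfold Re, Im in *; simpl in *; lra.
Qed.

Lemma hnorm_plus_sq f g : mem H f -> mem H g ->
  hnorm H (fun x => (f x + g x)%C) ^ 2
  = hnorm H f ^ 2 + hnorm H g ^ 2 + 2 * Re (inner H f g).
Proof.
intros Hf Hg. assert (Hp := mem_plus _ H f g Hf Hg).
rewrite !hnorm_sq by auto.
rewrite (inner_plus _ H f g _ Hf Hg Hp), (inner_conj _ H _ f Hp Hf), (inner_conj _ H _ g Hp Hg).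
rewrite (inner_plus _ H f g f Hf Hg Hf), (inner_plus _ H f g g Hf Hg Hg),
  (inner_conj _ H f g Hf Hg).
unfold Re, Im; simpl. ring.
Qed.

(** With [A] and [B] the norms of [f] and [g], expand the square of the norm of
    [B f - A g]. *)
Lemma re_inner_le f g : mem H f -> mem H g -> Re (inner H f g) <= hnorm H f * hnorm H g.
Proof.
intros Hf Hg.
assert (Pf := hnorm_nonneg f). assert (Pg := hnorm_nonneg g).
set (A := hnorm H f) in *. set (B := hnorm H g) in *.
assert (Q : 0 <= B ^ 2 * A ^ 2 + A ^ 2 * B ^ 2 - 2 * (A * B) * Re (inner H f g)).
{ assert (E := hnorm_plus_sq _ _ (mem_scal _ H (RtoC B) f Hf) (mem_scal _ H (RtoC (- A)) g Hg)).
  rewrite !hnorm_scal, !Cmod_R, Rabs_Ropp, !Rabs_pos_eq in E by auto. fold A B in E.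
  assert (Mg := mem_scal _ H (RtoC (- A)) g Hg).
  rewrite (inner_scal _ H (RtoC B) f _ Hf Mg), (inner_conj _ H _ f Mg Hf),
    (inner_scal _ H _ g f Hg Hf), (inner_conj _ H f g Hf Hg) in E.
  eapply Rle_trans; [apply pow2_ge_0 | rewrite E; apply Req_le].
  unfold Re, Im; simpl. ring. }
destruct (Req_dec A 0) as [ZA|NA].
{ rewrite (hnorm_eq_0 f Hf ZA).
  replace (fun _ : X => RtoC 0) with (fun x => (RtoC 0 * g x)%C)
    by (apply functional_extensionality; intros; ring).
  rewrite inner_scal by auto. unfold Re; simpl. rewrite ZA. lra. }
destruct (Req_dec B 0) as [ZB|NB].
{ rewrite (inner_conj _ H g f Hg Hf), (hnorm_eq_0 g Hg ZB).
  replace (fun _ : X => RtoC 0) with (fun x => (RtoC 0 * f x)%C)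
    by (apply functional_extensionality; intros; ring).
  rewrite inner_scal by auto. unfold Re; simpl. rewrite ZB. lra. }
assert (0 < A * B) by (apply Rmult_lt_0_compat; lra). nra.
Qed.

Lemma hnorm_triangle f g : mem H f -> mem H g ->
  hnorm H (fun x => (f x + g x)%C) <= hnorm H f + hnorm H g.
Proof.
intros Hf Hg. assert (Pf := hnorm_nonneg f). assert (Pg := hnorm_nonneg g).
apply Rsqr_incr_0; [| apply hnorm_nonneg | lra].
rewrite !Rsqr_pow2, hnorm_plus_sq by auto. assert (I := re_inner_le f g Hf Hg). lra.
Qed.

Lemma hnorm_sym f g : mem H f -> mem H g ->
  hnorm H (fun x => (f x - g x)%C) = hnorm H (fun x => (g x - f x)%C).
Proof.
intros Hf Hg.
replace (fun x => (f x - g x)%C) with (fun x => (Copp (RtoC 1) * (g x - f x))%C)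
  by (apply functional_extensionality; intros; ring).
rewrite hnorm_scal by now apply mem_minus. rewrite Cmod_opp, Cmod_1. ring.
Qed.

Lemma hnorm_dist f g h : mem H f -> mem H g -> mem H h ->
  hnorm H (fun x => (f x - h x)%C)
  <= hnorm H (fun x => (f x - g x)%C) + hnorm H (fun x => (g x - h x)%C).
Proof.
intros Hf Hg Hh.
replace (fun x => (f x - h x)%C) with (fun x => ((f x - g x) + (g x - h x))%C)
  by (apply functional_extensionality; intros; ring).
apply hnorm_triangle; now apply mem_minus.
Qed.

Lemma hnorm_zero : hnorm H (fun _ => RtoC 0) = 0.
Proof.
assert (M := mem_zero _ H).
replace (fun _ : X => RtoC 0) with (fun x : X => (RtoC 0 * RtoC 0)%C)
  by (apply functional_extensionality; intros; ring).
rewrite (hnorm_scal (RtoC 0) _ M), Cmod_0. ring.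
Qed.

(** Steps of at most half the current radius, and radii that at least halve,
    make the balls of centre [u n] and radius [r n] nested. *)
Lemma halving_limit (u : nat -> X -> C) (r : nat -> R) :
  (forall n, mem H (u n)) -> (forall n, 0 < r n) ->
  (forall n, r (S n) <= r n / 2) ->
  (forall n, hnorm H (fun x => (u (S n) x - u n x)%C) <= r n / 2) ->
  exists f, mem H f /\ forall n, hnorm H (fun x => (u n x - f x)%C) <= r n.
Proof.
intros Hu Pr Hr Hs.
assert (D : forall k n, hnorm H (fun x => (u (n + k)%nat x - u n x)%C) <= r n - r (n + k)%nat).
{ induction k as [|k IH]; intros n.
  - rewrite Nat.add_0_r.
    replace (fun x => (u n x - u n x)%C) with (fun _ : X => RtoC 0)
      by (apply functional_extensionality; intros; ring).
    rewrite hnorm_zero. lra.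
  - rewrite Nat.add_succ_r.
    eapply Rle_trans; [apply (hnorm_dist _ (u (n + k)%nat)); auto|].
    specialize (IH n). specialize (Hs (n + k)%nat). specialize (Hr (n + k)%nat). lra. }
assert (G : forall n, r n <= r O * (/ 2) ^ n).
{ induction n as [|n IH]; simpl; [lra|]. specialize (Hr n). nra. }
destruct (complete _ H u Hu) as [f [Hf L]].
{ intros eps He.
  assert (P0 := Pr O).
  destruct (pow_lt_1_zero (/ 2)) with (y := eps / (2 * r O)) as [N HN].
  { rewrite Rabs_pos_eq; lra. }
  { apply Rdiv_lt_0_compat; lra. }
  assert (S1 : r N < eps / 2).
  { eapply Rle_lt_trans; [apply G|].
    specialize (HN N (Nat.le_refl N)). rewrite Rabs_pos_eq in HN by (apply pow_le; lra).
    apply (Rmult_lt_compat_l (r O)) in HN; auto.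
    replace (r O * (eps / (2 * r O))) with (eps / 2) in HN by (field; lra). lra. }
  exists N. intros m n Hm Hn.
  assert (A := D (m - N)%nat N). assert (B := D (n - N)%nat N).
  replace (N + (m - N))%nat with m in A by lia. replace (N + (n - N))%nat with n in B by lia.
  rewrite hnorm_sym in B by auto.
  assert (T := hnorm_dist (u m) (u N) (u n) (Hu m) (Hu N) (Hu n)).
  assert (Pm := Pr m). assert (Pn := Pr n). unfold hnorm in *. lra. }
exists f. split; auto. intros n. apply Rnot_lt_le. intros Lt.
destruct (L (hnorm H (fun x => (u n x - f x)%C) - r n)) as [N HN]; [lra|].
specialize (HN (n + N)%nat). assert (D1 := D N n). rewrite hnorm_sym in D1 by auto.
assert (T := hnorm_dist (u n) (u (n + N)%nat) f (Hu _) (Hu _) Hf).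
assert (P1 := Pr (n + N)%nat).
assert (HN' : (N <= n + N)%nat) by lia. specialize (HN HN'). unfold hnorm in *. lra.
Qed.

End Norm.

(** * The bounded inverse theorem *)

Section OpenMapping.
Context {X1 X2 : Type} (K1 : HilbertFunctionSpace X1) (K2 : HilbertFunctionSpace X2).
Context (lambda : X1 -> C) (phi : X1 -> X2) (HW : invertible_wco K1 K2 lambda phi).

Notation W := (wco lambda phi).

Lemma wco_mem f : mem K2 f -> mem K1 (W f).
Proof. apply HW. Qed.

Lemma wco_plus f g : W (fun x => (f x + g x)%C) = (fun x => (W f x + W g x)%C).
Proof. apply functional_extensionality; intros x; unfold wco; ring. Qed.

Lemma wco_scal c f : W (fun x => (c * f x)%C) = (fun x => (c * W f x)%C).
Proof. apply functional_extensionality; intros x; unfold wco; ring. Qed.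

Lemma wco_minus f g : W (fun x => (f x - g x)%C) = (fun x => (W f x - W g x)%C).
Proof. apply functional_extensionality; intros x; unfold wco; ring. Qed.

Lemma wco_onto h : mem K1 h -> exists f, mem K2 f /\ W f = h.
Proof.
intros Hh. destruct (proj2 (proj2 HW) h Hh) as [f [Hf E]].
exists f. split; auto. now apply functional_extensionality.
Qed.

(** Gliding hump: otherwise nested balls can be chosen such that the [n]-th one
    is at positive distance from the image of the ball of radius [n]. Their
    common point would then have no preimage. *)
Lemma wco_almost_open :
  exists M, 0 < M /\ forall h, mem K1 h -> hnorm K1 h <= 1 ->
    forall eps, 0 < eps -> exists f, mem K2 f /\ hnorm K2 f <= M /\
      hnorm K1 (fun x => (W f x - h x)%C) < eps.
Proof.
apply NNPP. intros NE.
assert (Far : forall M, 0 < M -> exists h eps, mem K1 h /\ hnorm K1 h <= 1 /\ 0 < eps /\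
   forall f, mem K2 f -> hnorm K2 f <= M -> eps <= hnorm K1 (fun x => (W f x - h x)%C)).
{ intros M HM. apply NNPP. intros NF. apply NE. exists M. split; auto.
  intros h Hh Hn eps He. apply NNPP. intros NG. apply NF. exists h, eps.
  repeat split; auto. intros f Hf Hfn. apply Rnot_lt_le. intros L. apply NG. now exists f. }
clear NE.
destruct (dependent_choice
  (fun (_ : nat) (p : (X1 -> C) * R) => mem K1 (fst p) /\ 0 < snd p)
  (fun n p q => snd q <= snd p / 2 /\
     hnorm K1 (fun x => (fst q x - fst p x)%C) <= snd p / 2 /\
     forall f, mem K2 f -> hnorm K2 f <= INR n ->
       2 * snd q <= hnorm K1 (fun x => (W f x - fst q x)%C))
  (fun _ => RtoC 0, 1)) as [u [_ [HP HQ]]].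
{ split; [apply mem_zero | simpl; lra]. }
{ intros n [x r] [Hx Hr]; simpl in *.
  destruct (Far (2 * (INR n + 1) / r)) as [h [eps [Hh [Hh1 [He F]]]]].
  { apply Rdiv_lt_0_compat; auto. assert (Pn := pos_INR n). lra. }
  set (t := RtoC (r / 2)).
  (* If the images of two functions of norm at most [n] came close to
     [x + t h] and [x - t h], half their difference would come close to [t h]. *)
  assert (Ex : exists y, mem K1 y /\ hnorm K1 (fun z => (y z - x z)%C) <= r / 2 /\
     forall f, mem K2 f -> hnorm K2 f <= INR n -> r / 2 * eps <= hnorm K1 (fun z => (W f z - y z)%C)).
  { assert (Mt := mem_scal _ K1 t h Hh).
    assert (Nt : hnorm K1 (fun z => (t * h z)%C) <= r / 2).
    { rewrite hnorm_scal by auto. unfold t. rewrite Cmod_R, Rabs_pos_eq by lra.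
      assert (P := hnorm_nonneg K1 h). nra. }
    apply NNPP. intros NY.
    assert (Y : forall y, mem K1 y -> hnorm K1 (fun z => (y z - x z)%C) <= r / 2 ->
      exists f, mem K2 f /\ hnorm K2 f <= INR n /\
        hnorm K1 (fun z => (W f z - y z)%C) < r / 2 * eps).
    { intros y Hy Hyx. apply NNPP. intros NF. apply NY. exists y. repeat split; auto.
      intros f Hf Hfn. apply Rnot_lt_le. intros L. apply NF. now exists f. }
    destruct (Y (fun z => (x z + t * h z)%C)) as [f [Hf [Nf Lf]]].
    { now apply mem_plus. }
    { replace (fun z => (x z + t * h z - x z)%C) with (fun z => (t * h z)%C); auto.
      apply functional_extensionality; intros; ring. }
    destruct (Y (fun z => (x z - t * h z)%C)) as [g [Hg [Ng Lg]]].
    { now apply mem_minus. }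
    { replace (fun z => (x z - t * h z - x z)%C) with (fun z => (Copp (RtoC 1) * (t * h z))%C).
      - rewrite hnorm_scal, Cmod_opp, Cmod_1 by auto. lra.
      - apply functional_extensionality; intros; ring. }
    set (c := RtoC (/ r)).
    assert (Ec : Cmod c = / r).
    { unfold c. rewrite Cmod_R, Rabs_pos_eq; auto. apply Rlt_le, Rinv_0_lt_compat; lra. }
    assert (Ir : 0 < / r) by (apply Rinv_0_lt_compat; lra).
    assert (Hd := mem_minus K2 f g Hf Hg).
    assert (B : eps <= hnorm K1 (fun z => (W (fun z => (c * (f z - g z))%C) z - h z)%C)).
    { apply F. now apply mem_scal. rewrite hnorm_scal, Ec by auto.
      assert (T := hnorm_triangle K2 f (fun z => (Copp (RtoC 1) * g z)%C) Hf (mem_scal _ K2 _ g Hg)).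
      rewrite hnorm_scal, Cmod_opp, Cmod_1 in T by auto.
      replace (fun z => (f z + Copp (RtoC 1) * g z)%C) with (fun z => (f z - g z)%C) in T
        by (apply functional_extensionality; intros; ring).
      unfold Rdiv. rewrite Rmult_comm. apply Rmult_le_compat_r; lra. }
    replace (fun z => (W (fun z => (c * (f z - g z))%C) z - h z)%C) with
      (fun z => (c * ((W f z - (x z + t * h z)) - (W g z - (x z - t * h z))))%C) in B.
    2:{ apply functional_extensionality; intros z. unfold wco.
        assert (CT : (c * (t + t) = RtoC 1)%C).
        { unfold c, t. rewrite <- RtoC_plus, <- RtoC_mult. f_equal. field. lra. }
        transitivity (c * (lambda z * f (phi z) - lambda z * g (phi z)) - c * (t + t) * h z)%C; [ring|].
        rewrite CT. ring. }
    assert (M1 : mem K1 (fun z => (W f z - (x z + t * h z))%C)).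
    { apply mem_minus. now apply wco_mem. now apply mem_plus. }
    assert (M2 : mem K1 (fun z => (W g z - (x z - t * h z))%C)).
    { apply mem_minus. now apply wco_mem. now apply mem_minus. }
    rewrite hnorm_scal, Ec in B by (now apply mem_minus).
    assert (T := hnorm_triangle K1 _ _ M1 (mem_scal _ K1 (Copp (RtoC 1)) _ M2)).
    rewrite hnorm_scal, Cmod_opp, Cmod_1 in T by auto.
    match type of T with hnorm _ ?F <= _ => match type of B with context [hnorm K1 ?G] =>
      replace F with G in T by (apply functional_extensionality; intros; ring) end end.
    set (q := hnorm K1 _) in T, B.
    assert (q < r * eps) by lra.
    apply (Rmult_lt_compat_l (/ r)) in H; auto.
    rewrite <- Rmult_assoc, Rinv_l in H by lra. lra. }
  destruct Ex as [y [Hy [Hyx Fy]]].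
  assert (Pe : 0 < r / 2 * eps) by (apply Rmult_lt_0_compat; lra).
  exists (y, Rmin (r / 2) (r / 2 * eps / 2)). simpl. repeat split; auto.
  - apply Rmin_pos; lra.
  - apply Rmin_l.
  - intros f Hf Nf. specialize (Fy f Hf Nf). assert (Q := Rmin_r (r / 2) (r / 2 * eps / 2)). lra. }
destruct (halving_limit K1 (fun n => fst (u n)) (fun n => snd (u n))) as [y [Hy L]];
  try apply HP; try apply HQ.
destruct (wco_onto y Hy) as [f [Hf E]].
destruct (INR_archimed 1 (hnorm K2 f)) as [n Hn]; [lra|].
destruct (HQ n) as [_ [_ A]]. specialize (A f Hf). specialize (L (S n)).
rewrite E, hnorm_sym in A by (auto; apply HP).
destruct (HP (S n)) as [_ P]. assert (hnorm K2 f <= INR n) by lra.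
specialize (A H). lra.
Qed.

(** The bounded inverse theorem: almost openness is improved to openness by
    successive approximation. *)
Lemma wco_bounded_below :
  exists M, 0 < M /\ forall f, mem K2 f -> hnorm K2 f <= M * hnorm K1 (W f).
Proof.
destruct wco_almost_open as [M [HM AO]].
assert (Sc : forall h r, mem K1 h -> 0 < r -> hnorm K1 h <= r ->
  exists f, mem K2 f /\ hnorm K2 f <= M * r /\ hnorm K1 (fun x => (W f x - h x)%C) <= r / 2).
{ intros h r Hh Hr Hn. assert (Ir : 0 < / r) by now apply Rinv_0_lt_compat.
  assert (Er : (RtoC r * RtoC (/ r) = RtoC 1)%C) by (rewrite <- RtoC_mult; f_equal; field; lra).
  destruct (AO (fun x => (RtoC (/ r) * h x)%C)) with (eps := / 2) as [f [Hf [Nf Lf]]]; [..|lra|].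
  - now apply mem_scal.
  - rewrite hnorm_scal, Cmod_R, Rabs_pos_eq by (auto; lra).
    apply (Rmult_le_compat_l (/ r)) in Hn; [|lra]. now rewrite Rinv_l in Hn by lra.
  - exists (fun x => (RtoC r * f x)%C). split; [now apply mem_scal | split].
    + rewrite hnorm_scal, Cmod_R, Rabs_pos_eq by (auto; lra). nra.
    + replace (fun x => (W (fun x => (RtoC r * f x)%C) x - h x)%C) with
        (fun x => (RtoC r * (W f x - RtoC (/ r) * h x))%C).
      * rewrite hnorm_scal, Cmod_R, Rabs_pos_eq
          by (lra || (apply mem_minus; [now apply wco_mem | now apply mem_scal])). nra.
      * apply functional_extensionality; intros x. rewrite wco_scal.
        transitivity (RtoC r * W f x - (RtoC r * RtoC (/ r)) * h x)%C; [ring|].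
        rewrite Er. ring. }
exists (2 * M). split; [lra|]. intros f Hf. assert (Hh := wco_mem f Hf).
destruct (Req_dec (hnorm K1 (W f)) 0) as [Z|NZ].
{ assert (E := hnorm_eq_0 K1 _ Hh Z).
  assert (f = fun _ => RtoC 0) as ->.
  { apply functional_extensionality. apply (proj1 (proj2 HW)); auto. apply mem_zero.
    intros x. rewrite E. unfold wco. ring. }
  rewrite hnorm_zero, Z. lra. }
set (h := W f) in *. set (R0 := hnorm K1 h).
assert (PR : 0 < R0) by (assert (P := hnorm_nonneg K1 h); unfold R0; lra).
assert (P2 : forall n, 0 < (/ 2) ^ n) by (intros; apply pow_lt; lra).
destruct (dependent_choice
  (fun n g => mem K2 g /\ hnorm K1 (fun x => (h x - W g x)%C) <= R0 * (/ 2) ^ n)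
  (fun n g g' => hnorm K2 (fun x => (g' x - g x)%C) <= 2 * M * R0 * (/ 2) ^ n / 2)
  (fun _ => RtoC 0)) as [u [U0 [HP HQ]]].
{ split. apply mem_zero.
  replace (fun x => (h x - W (fun _ => RtoC 0) x)%C) with h
    by (apply functional_extensionality; intros; unfold wco; ring).
  unfold R0; simpl; lra. }
{ intros n g [Hg Ng].
  destruct (Sc (fun x => (h x - W g x)%C) (R0 * (/ 2) ^ n)) as [k [Hk [Nk Lk]]]; auto.
  - apply mem_minus; auto. now apply wco_mem.
  - apply Rmult_lt_0_compat; auto.
  - exists (fun x => (g x + k x)%C). split; [split|].
    + now apply mem_plus.
    + rewrite wco_plus.
      replace (fun x => (h x - (W g x + W k x))%C)
        with (fun x => (Copp (RtoC 1) * (W k x - (h x - W g x)))%C)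
        by (apply functional_extensionality; intros; ring).
      rewrite hnorm_scal, Cmod_opp, Cmod_1
        by (apply mem_minus; [now apply wco_mem | apply mem_minus; auto; now apply wco_mem]).
      simpl. lra.
    + replace (fun x => (g x + k x - g x)%C) with k
        by (apply functional_extensionality; intros; ring). lra. }
assert (Hu : forall n, mem K2 (u n)) by (intros; apply HP).
destruct (halving_limit K2 u (fun n => 2 * M * R0 * (/ 2) ^ n)) as [g [Hg L]]; auto.
{ intros n. specialize (P2 n). assert (0 < M * R0) by (apply Rmult_lt_0_compat; lra). nra. }
{ intros n. simpl. lra. }
assert (fg : f = g).
{ apply functional_extensionality. apply (proj1 (proj2 HW)); auto.
  destruct (proj1 HW) as [_ [B HB]].
  assert (Z : hnorm K1 (fun x => (h x - W g x)%C) = 0).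
  { apply Rle_antisym; [|apply hnorm_nonneg].
    apply (is_lim_seq_le (fun _ => hnorm K1 (fun x => (h x - W g x)%C))
      (fun n => (R0 + Rabs B * (2 * M * R0)) * (/ 2) ^ n)
      (hnorm K1 (fun x => (h x - W g x)%C)) 0).
    - intros n.
      eapply Rle_trans.
      { apply (hnorm_dist K1 h (W (u n)) (W g)); auto; apply wco_mem; auto. }
      specialize (HB (fun x => (u n x - g x)%C) (mem_minus K2 _ _ (Hu n) Hg)).
      rewrite wco_minus in HB. specialize (L n).
      assert (P := hnorm_nonneg K2 (fun x => (u n x - g x)%C)).
      assert (A := Rle_abs B). assert (A' := Rabs_pos B).
      assert (B * hnorm K2 (fun x => (u n x - g x)%C) <= Rabs B * (2 * M * R0 * (/ 2) ^ n)).
      { eapply Rle_trans; [apply Rmult_le_compat_r|apply Rmult_le_compat_l]; eauto. }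
      destruct (HP n) as [_ Q]. lra.
    - apply is_lim_seq_const.
    - replace (Finite 0) with (Rbar_mult (R0 + Rabs B * (2 * M * R0)) 0) by (simpl; f_equal; ring).
      apply is_lim_seq_scal_l. apply is_lim_seq_geom. rewrite Rabs_pos_eq; lra. }
  apply hnorm_eq_0 in Z.
  - intros x. apply (f_equal (fun k => k x)) in Z. simpl in Z.
    change (h x = W g x). replace (h x) with ((h x - W g x) + W g x)%C by ring.
    rewrite Z. ring.
  - apply mem_minus; auto. now apply wco_mem. }
specialize (L O). rewrite U0, <- fg in L. simpl in L.
replace (fun x => (RtoC 0 - f x)%C) with (fun x => (Copp (RtoC 1) * f x)%C) in L
  by (apply functional_extensionality; intros; ring).
rewrite hnorm_scal, Cmod_opp, Cmod_1 in L by auto. fold R0. lra.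
Qed.

End OpenMapping.

(** * Multiplication by the variable and Taylor polynomials in H_s *)

Lemma Hs_norm_sq s f a : has_coef s f a ->
  hnorm (Hs s) f ^ 2 = Series (fun n => weight s n * Cmod (a n) ^ 2).
Proof.
intros Ha. unfold hnorm. simpl inner. rewrite (Hs_norm_eq s f a Ha).
apply pow2_sqrt, Series_nonneg; [apply weight_sq_nonneg | apply Ha].
Qed.

Definition shift (a : nat -> C) (n : nat) : C :=
  match n with O => RtoC 0 | S k => a k end.

(** The bound on the ratio of consecutive weights that makes multiplication by
    [z] a bounded operator on [H_s]. *)
Lemma weight_S_le s n : weight s (S n) <= Rpower 2 (Rabs s) * weight s n.
Proof.
assert (I1 : 0 < INR (S n)) by (apply lt_0_INR; lia).
assert (I2 : INR (S (S n)) = INR (S n) + 1) by apply S_INR.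
assert (I3 : 1 <= INR (S n)) by (rewrite S_INR; assert (P := pos_INR n); lra).
unfold weight, Rpower. rewrite <- exp_plus.
apply Rnot_lt_le. intros Lt. apply exp_lt_inv in Lt.
assert (L1 : ln (INR (S n)) <= ln (INR (S (S n)))) by (apply ln_le; lra).
assert (L2 : ln (INR (S (S n))) <= ln 2 + ln (INR (S n))).
{ rewrite <- ln_mult by lra. apply ln_le; lra. }
set (x := ln (INR (S n))) in *. set (y := ln (INR (S (S n)))) in *.
assert (A := Rle_abs (- s)). rewrite Rabs_Ropp in A. assert (P := Rabs_pos s). nra.
Qed.

Lemma has_coef_mul_z s f a : has_coef s f a ->
  has_coef s (fun x => (pt x * f x)%C) (shift a).
Proof.
intros [Fa Ha]. split.
- apply (ex_series_incr_1 (fun n => weight s n * Cmod (shift a n) ^ 2)).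
  apply (ex_series_le_R _ (fun n => Rpower 2 (Rabs s) * (weight s n * Cmod (a n) ^ 2))).
  + intros n. rewrite Rabs_pos_eq by (apply (weight_sq_nonneg s (shift a) (S n))).
    rewrite <- Rmult_assoc. apply Rmult_le_compat_r; [apply pow2_ge_0 | apply weight_S_le].
  + apply (ex_series_scal (V := R_NormedModule) (Rpower 2 (Rabs s))). exact Fa.
- intros x. apply is_series_decr_1.
  match goal with |- is_series _ ?l => replace l with (pt x * f x)%C end.
  2:{ change ((pt x * f x)%C = (pt x * f x + - (RtoC 0 * pt x ^ O))%C). ring. }
  generalize (is_series_C_scal (pt x) _ _ (Ha x)). apply is_series_ext.
  intros n. simpl. ring.
Qed.

Lemma mul_z_bounded s : exists B, 0 <= B /\ forall f, mem (Hs s) f ->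
  mem (Hs s) (fun x => (pt x * f x)%C) /\
  hnorm (Hs s) (fun x => (pt x * f x)%C) <= B * hnorm (Hs s) f.
Proof.
assert (PB : 0 < Rpower 2 (Rabs s)) by apply exp_pos.
exists (sqrt (Rpower 2 (Rabs s))). split; [apply sqrt_pos|].
intros f [a Ha]. assert (Hz := has_coef_mul_z s f a Ha).
split; [eexists; exact Hz|].
apply Rsqr_incr_0; [|apply hnorm_nonneg | apply Rmult_le_pos; [apply sqrt_pos | apply hnorm_nonneg]].
rewrite !Rsqr_pow2, Rpow_mult_distr, pow2_sqrt by lra.
rewrite (Hs_norm_sq _ _ _ Ha), (Hs_norm_sq _ _ _ Hz).
rewrite Series_incr_1 by apply Hz.
replace (Cmod (shift a O)) with 0 by (simpl; now rewrite Cmod_0).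
rewrite <- Series_scal_l.
replace (weight s 0 * 0 ^ 2) with 0 by ring. rewrite Rplus_0_l.
apply Series_le.
- intros n. split; [apply (weight_sq_nonneg s (shift a) (S n))|].
  rewrite <- Rmult_assoc. apply Rmult_le_compat_r; [apply pow2_ge_0 | apply weight_S_le].
- apply (ex_series_scal (V := R_NormedModule) (Rpower 2 (Rabs s))). apply Ha.
Qed.

Definition delta (n k : nat) : C := if Nat.eqb n k then RtoC 1 else RtoC 0.

Lemma has_coef_pow s n : has_coef s (fun x => (pt x ^ n)%C) (delta n).
Proof.
induction n as [|n IH].
- split.
  + eexists. apply (is_series_finite _ O). intros [|n] Hn; [lia|].
    unfold delta; simpl. rewrite Cmod_0. ring.
  + intros x. apply is_series_decr_1.
    match goal with |- is_series _ ?l => replace l with (RtoC 0) end.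
    2:{ change (RtoC 0 = (pt x ^ O + - (RtoC 1 * pt x ^ O))%C). ring. }
    destruct (Hs_zero s) as [a Ha].
    generalize (is_series_C_scal (RtoC 0) _ _ (proj2 Ha x)).
    replace (RtoC 0 * RtoC 0)%C with (RtoC 0) by ring.
    apply is_series_ext. intros n. unfold delta; simpl. ring.
- replace (delta (S n)) with (shift (delta n))
    by (apply functional_extensionality; intros [|k]; reflexivity).
  exact (has_coef_mul_z s _ _ IH).
Qed.

Definition trunc (c : nat -> C) (N k : nat) : C := if Nat.leb k N then c k else RtoC 0.

Lemma trunc_le c N k : (k <= N)%nat -> trunc c N k = c k.
Proof. intros H. unfold trunc. now rewrite (proj2 (Nat.leb_le k N) H). Qed.

Lemma trunc_gt c N k : (N < k)%nat -> trunc c N k = RtoC 0.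
Proof. intros H. unfold trunc. now rewrite (proj2 (Nat.leb_gt k N) H). Qed.

Definition taylor (s : R) (c : nat -> C) (N : nat) (x : dom s) : C :=
  csum (fun k => (c k * pt x ^ k)%C) N.

Lemma has_coef_poly s c N : has_coef s (taylor s c N) (trunc c N).
Proof.
induction N as [|N IH].
- replace (taylor s c O) with (fun x : dom s => (c O * pt x ^ O)%C).
  2:{ apply functional_extensionality; intros x. unfold taylor. now rewrite csum_O. }
  replace (trunc c O) with (fun k => (c O * delta O k)%C).
  2:{ apply functional_extensionality; intros [|k]; unfold trunc, delta; simpl; ring. }
  apply has_coef_scal, has_coef_pow.
- replace (taylor s c (S N)) with (fun x : dom s => (taylor s c N x + c (S N) * pt x ^ (S N))%C).
  2:{ apply functional_extensionality; intros x. unfold taylor. now rewrite csum_S. }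
  replace (trunc c (S N)) with (fun k => (trunc c N k + c (S N) * delta (S N) k)%C).
  + apply has_coef_plus; auto. apply has_coef_scal, has_coef_pow.
  + apply functional_extensionality; intros k. unfold delta.
    destruct (Nat.eqb_spec (S N) k) as [E|E].
    * subst k. rewrite trunc_gt, trunc_le by lia. ring.
    * destruct (Nat.le_gt_cases k N).
      -- rewrite !trunc_le by lia. ring.
      -- rewrite !trunc_gt by lia. ring.
Qed.

Lemma poly_norm_sq s c N :
  hnorm (Hs s) (taylor s c N) ^ 2 = sum_n (fun n => weight s n * Cmod (c n) ^ 2) N.
Proof.
rewrite (Hs_norm_sq _ _ _ (has_coef_poly s c N)).
transitivity (sum_n (fun n => weight s n * Cmod (trunc c N n) ^ 2) N).
- apply is_series_unique, is_series_finite. intros n Hn.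
  rewrite trunc_gt, Cmod_0 by auto. ring.
- apply sum_n_ext_loc. intros n Hn. now rewrite trunc_le.
Qed.

Lemma poly_approx s f a : has_coef s f a ->
  is_lim_seq (fun N => hnorm (Hs s) (fun x => (f x - taylor s a N x)%C)) 0.
Proof.
intros Ha. set (u := fun n => weight s n * Cmod (a n) ^ 2).
assert (E : forall N, sqrt (Series u - sum_n u N) =
  hnorm (Hs s) (fun x => (f x - taylor s a N x)%C)).
{ intros N.
  rewrite <- (sqrt_pow2 (hnorm _ _)) by apply hnorm_nonneg. f_equal.
  rewrite (Hs_norm_sq _ _ _ (has_coef_minus _ _ _ _ _ Ha (has_coef_poly s a N))).
  symmetry. apply is_series_unique.
  set (v := fun n => weight s n * Cmod (trunc a N n) ^ 2).
  assert (Ev : sum_n v N = sum_n u N).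
  { apply sum_n_ext_loc. intros n Hn. unfold v, u. now rewrite trunc_le. }
  rewrite <- Ev.
  apply (is_series_ext (fun n => u n - v n)).
  - intros n. unfold u, v. destruct (Nat.le_gt_cases n N).
    + rewrite trunc_le by auto. replace (a n - a n)%C with (RtoC 0) by ring.
      rewrite Cmod_0. simpl. ring.
    + rewrite trunc_gt by auto. replace (a n - RtoC 0)%C with (a n) by ring.
      rewrite Cmod_0. simpl. ring.
  - apply (is_series_minus (V := R_NormedModule)).
    + apply (Series_correct _ (proj1 Ha)).
    + apply is_series_finite. intros n Hn. unfold v. rewrite trunc_gt, Cmod_0 by auto. ring. }
apply (is_lim_seq_ext _ _ _ E).
rewrite <- sqrt_0. apply is_lim_seq_continuous.
- apply continuity_pt_sqrt. lra.
- replace 0 with (Series u - Series u) by ring.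
  apply is_lim_seq_minus'; [apply is_lim_seq_const|].
  apply (Series_correct _ (proj1 Ha)).
Qed.

(** * Inverse images under a weighted composition operator *)

Lemma Cmod_sq_conj (c : C) : (Cconj c * c)%C = RtoC (Cmod c ^ 2).
Proof. rewrite Cmod_sq. apply injective_projections; unfold Re, Im; simpl; ring. Qed.

(** Bessel's inequality: [h -> (W^-1 h)(w)] is a bounded functional on [H_s], so
    its values [(n+1)^(s/2) f n w] on the orthonormal basis of normalised
    monomials are square summable. *)
Lemma inverse_monomials_to_zero {X : Type} (s : R) (K : HilbertFunctionSpace X)
  (lambda : dom s -> C) (phi : dom s -> X) (f : nat -> X -> C) (w : X) :
  invertible_wco (Hs s) K lambda phi ->
  (forall n, mem K (f n) /\ wco lambda phi (f n) = (fun x => (pt x ^ n)%C)) ->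
  is_lim_seq (fun n => Rpower (INR (S n)) s * Cmod (f n w) ^ 2) 0.
Proof.
intros HW Hf. apply ex_series_lim_0.
destruct (wco_bounded_below _ _ _ _ HW) as [M [HM BB]].
destruct (eval_bounded _ K w) as [E0 HE0].
set (E := Rabs E0).
assert (HE : forall g, mem K g -> Cmod (g w) <= E * hnorm K g).
{ intros g Hg. eapply Rle_trans; [apply HE0, Hg|].
  apply Rmult_le_compat_r; [apply hnorm_nonneg | apply Rle_abs]. }
assert (PE : 0 <= E) by apply Rabs_pos.
set (b := fun n => Rpower (INR (S n)) s * Cmod (f n w) ^ 2).
assert (Pb : forall n, 0 <= b n).
{ intros n. apply Rmult_le_pos; [apply Rlt_le, exp_pos | apply pow2_ge_0]. }
(* The test functions are the partial sums of the representing vector of the functional. *)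
set (c := fun n => (RtoC (Rpower (INR (S n)) s) * Cconj (f n w))%C).
set (g := fun N x => csum (fun n => (c n * f n x)%C) N).
assert (Hg : forall N, mem K (g N) /\ wco lambda phi (g N) = taylor s c N /\
  g N w = RtoC (sum_n b N)).
{ induction N as [|N [IH1 [IH2 IH3]]].
  - unfold g. split; [|split].
    + replace (fun x => csum (fun n => (c n * f n x)%C) O) with (fun x => (c O * f O x)%C)
        by (apply functional_extensionality; intros; now rewrite csum_O).
      now apply mem_scal, Hf.
    + apply functional_extensionality; intros x. unfold wco, taylor. rewrite !csum_O.
      rewrite <- (f_equal (fun k => k x) (proj2 (Hf O))). unfold wco. ring.
    + rewrite csum_O, sum_O. unfold c, b. rewrite RtoC_mult, <- Cmod_sq_conj.
      symmetry. apply Cmult_assoc.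
  - assert (ES : g (S N) = fun x => (g N x + c (S N) * f (S N) x)%C).
    { apply functional_extensionality; intros x. unfold g. now rewrite csum_S. }
    split; [|split].
    + rewrite ES. apply mem_plus; auto. now apply mem_scal, Hf.
    + rewrite ES, wco_plus, wco_scal, IH2, (proj2 (Hf (S N))).
      apply functional_extensionality; intros x. unfold taylor. now rewrite csum_S.
    + rewrite ES, IH3, sum_n_S, RtoC_plus. unfold c, b. f_equal.
      rewrite RtoC_mult, <- Cmod_sq_conj. symmetry. apply Cmult_assoc. }
apply (bounded_series b ((E * M) ^ 2)); auto.
intros N. destruct (Hg N) as [G1 [G2 G3]].
assert (PS : 0 <= sum_n b N).
{ eapply Rle_trans; [apply (Pb N) | apply term_le_sum_n; auto]. }
assert (L : sum_n b N <= E * M * hnorm (Hs s) (taylor s c N)).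
{ rewrite <- (Rabs_pos_eq (sum_n b N)), <- Cmod_R, <- G3 by auto.
  eapply Rle_trans; [apply HE; auto|]. rewrite Rmult_assoc, <- G2.
  apply Rmult_le_compat_l; auto. }
assert (Q : hnorm (Hs s) (taylor s c N) ^ 2 = sum_n b N).
{ rewrite poly_norm_sq. apply sum_n_ext. intros n. unfold c, b.
  match goal with |- @eq _ ?x ?y => change (@eq R x y) end.
  rewrite Cmod_mult, Cmod_R, Cmod_conj, Rabs_pos_eq by (apply Rlt_le, exp_pos).
  transitivity ((weight s n * Rpower (INR (S n)) s) * (Rpower (INR (S n)) s * Cmod (f n w) ^ 2));
    [ring | rewrite weight_inv; ring]. }
assert (PN := hnorm_nonneg (Hs s) (taylor s c N)).
set (q := hnorm (Hs s) (taylor s c N)) in *. rewrite <- Q in *.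
assert (0 <= E * M) by (apply Rmult_le_pos; lra).
apply pow_incr. split; auto. nra.
Qed.

(** [W] intertwines multiplication by a polynomial [p] with multiplication by
    [p o phi], so the bounded operator [W^-1 M_z W] commutes with multiplication
    by polynomials and maps [p] to [p tau], where [tau] is the image of the
    constant function [1]. Polynomials are dense in [H_t], hence it is the
    multiplication by [tau]. *)
Lemma conjugate_of_mul_z (s t : R) (lambda : dom s -> C) (phi : dom s -> dom t)
  (tau f g : dom t -> C) :
  invertible_wco (Hs s) (Hs t) lambda phi ->
  mem (Hs t) tau -> (forall x, wco lambda phi tau x = (pt x * lambda x)%C) ->
  mem (Hs t) f -> mem (Hs t) g ->
  (forall x, wco lambda phi g x = (pt x * wco lambda phi f x)%C) ->
  forall w, g w = (tau w * f w)%C.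
Proof.
intros HW Ht Wt Hf Hg Wg w.
destruct (wco_bounded_below _ _ _ _ HW) as [M [HM BB]].
destruct (proj1 HW) as [_ [M' BA]].
destruct (mul_z_bounded s) as [B [PB HB]].
destruct (eval_bounded _ (Hs t) w) as [E HE].
destruct (Hf) as [a Ha].
assert (Hp : forall N, mem (Hs t) (taylor t a N)) by (intros; eexists; apply has_coef_poly).
assert (Hpow : forall k, mem (Hs t) (fun x => (pt x ^ k * tau x)%C)).
{ destruct (mul_z_bounded t) as [Bt [_ HBt]].
  induction k as [|k IH].
  - replace (fun x : dom t => (pt x ^ O * tau x)%C) with tau; auto.
    apply functional_extensionality; intros; simpl; ring.
  - replace (fun x : dom t => (pt x ^ S k * tau x)%C)
      with (fun x : dom t => (pt x * (pt x ^ k * tau x))%C).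
    + now apply HBt.
    + apply functional_extensionality; intros; simpl; ring. }
assert (Hq : forall N, mem (Hs t) (fun x => (taylor t a N x * tau x)%C)).
{ induction N as [|N IH].
  - replace (fun x => (taylor t a O x * tau x)%C) with (fun x => (a O * (pt x ^ O * tau x))%C).
    + now apply mem_scal.
    + apply functional_extensionality; intros. unfold taylor. rewrite csum_O. ring.
  - replace (fun x => (taylor t a (S N) x * tau x)%C)
      with (fun x => (taylor t a N x * tau x + a (S N) * (pt x ^ (S N) * tau x))%C).
    + apply mem_plus; auto. now apply mem_scal.
    + apply functional_extensionality; intros. unfold taylor. rewrite csum_S. ring. }
set (d := fun N => hnorm (Hs t) (fun x => (f x - taylor t a N x)%C)).
assert (L1 : forall N, Cmod (g w - taylor t a N w * tau w)%C <= Rabs E * (M * (B * (Rabs M' * d N)))).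
{ intros N. assert (Hd := mem_minus (Hs t) _ _ Hf (Hp N)).
  assert (Hgq := mem_minus (Hs t) _ _ Hg (Hq N)).
  assert (Id : hnorm (Hs s) (wco lambda phi (fun x => (f x - taylor t a N x)%C)) <= Rabs M' * d N).
  { eapply Rle_trans; [apply BA; auto|].
    apply Rmult_le_compat_r; [apply hnorm_nonneg | apply Rle_abs]. }
  eapply Rle_trans; [apply (HE _ Hgq)|].
  eapply Rle_trans; [apply Rmult_le_compat_r; [apply hnorm_nonneg | apply (Rle_abs E)]|].
  apply Rmult_le_compat_l; [apply Rabs_pos|].
  eapply Rle_trans; [apply (BB _ Hgq)|]. apply Rmult_le_compat_l; [lra|].
  replace (wco lambda phi (fun x => (g x - taylor t a N x * tau x)%C)) with
    (fun x => (pt x * wco lambda phi (fun x => (f x - taylor t a N x)%C) x)%C).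
  - eapply Rle_trans; [apply HB; now apply (wco_mem _ _ _ _ HW)|].
    now apply Rmult_le_compat_l.
  - apply functional_extensionality; intros x. specialize (Wt x). specialize (Wg x).
    unfold wco in *.
    transitivity (pt x * (lambda x * f (phi x)) - taylor t a N (phi x) * (pt x * lambda x))%C; [ring|].
    rewrite <- Wg, <- Wt. ring. }
assert (L2 : forall N, Cmod (f w - taylor t a N w)%C <= Rabs E * d N).
{ intros N. eapply Rle_trans; [apply (HE _ (mem_minus (Hs t) _ _ Hf (Hp N)))|].
  apply Rmult_le_compat_r; [apply hnorm_nonneg | apply Rle_abs]. }
set (D := Rabs E * (M * (B * Rabs M')) + Cmod (tau w) * Rabs E).
assert (Z : Cmod (g w - tau w * f w)%C = 0).
{ apply Rle_antisym; [|apply Cmod_ge_0].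
  apply (is_lim_seq_le (fun _ => Cmod (g w - tau w * f w)%C) (fun N => D * d N)
    (Cmod (g w - tau w * f w)%C) 0).
  - intros N.
    replace (g w - tau w * f w)%C with
      ((g w - taylor t a N w * tau w) + Copp (tau w) * (f w - taylor t a N w))%C by ring.
    eapply Rle_trans; [apply Cmod_triangle|]. rewrite Cmod_mult, Cmod_opp.
    specialize (L1 N). specialize (L2 N).
    apply (Rmult_le_compat_l (Cmod (tau w))) in L2; [|apply Cmod_ge_0].
    unfold D. lra.
  - apply is_lim_seq_const.
  - replace (Finite 0) with (Finite (D * 0)) by (rewrite Rmult_0_r; reflexivity).
    exact (is_lim_seq_mult' (fun _ => D) d D 0 (is_lim_seq_const D) (poly_approx t f a Ha)). }
apply Cmod_eq_0 in Z.
replace (g w) with ((g w - tau w * f w) + tau w * f w)%C by ring. rewrite Z. ring.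
Qed.

(** * Parseval's identity on roots of unity *)

Definition cis (x : R) : C := (cos x, sin x).

Lemma cis_plus x y : cis (x + y) = (cis x * cis y)%C.
Proof. unfold cis. rewrite cos_plus, sin_plus. apply injective_projections; simpl; ring. Qed.

Lemma cis_0 : cis 0 = RtoC 1.
Proof. unfold cis. rewrite cos_0, sin_0. reflexivity. Qed.

Lemma Cmod_cis x : Cmod (cis x) = 1.
Proof.
unfold Cmod, cis; simpl fst; simpl snd. rewrite <- sqrt_1. f_equal.
rewrite <- (sin2_cos2 x). unfold Rsqr. ring.
Qed.

Lemma cis_pow x n : (cis x ^ n)%C = cis (INR n * x).
Proof.
induction n as [|n IH].
- simpl (INR 0). rewrite Rmult_0_l, cis_0. reflexivity.
- rewrite S_INR. replace ((INR n + 1) * x) with (x + INR n * x) by ring.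
  rewrite cis_plus, <- IH. reflexivity.
Qed.

Lemma Cconj_cis x : Cconj (cis x) = cis (- x).
Proof. unfold cis, Cconj. rewrite cos_neg, sin_neg. reflexivity. Qed.

Lemma cis_neq_1 x : 0 < x < 2 * PI -> cis x <> RtoC 1.
Proof.
intros Hx E. apply (f_equal fst) in E. simpl in E.
replace x with (2 * (x / 2)) in E by field. rewrite cos_2a_sin in E.
assert (0 < sin (x / 2)) by (apply sin_gt_0; lra). nra.
Qed.

Lemma geometric_sum (q : C) N : ((RtoC 1 - q) * csum (fun j => (q ^ j)%C) N = RtoC 1 - q ^ (S N))%C.
Proof.
induction N as [|N IH].
- rewrite csum_O. simpl. ring.
- rewrite csum_S, Cmult_plus_distr_l, IH. simpl. ring.
Qed.

(** The angle between neighbouring roots of unity of order [N+1]. *)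
Definition step (N : nat) : R := 2 * PI / INR (S N).

Lemma roots_orthogonal N k m : (k < m)%nat -> (m <= N)%nat ->
  csum (fun j => (cis (INR j * step N) ^ k * Cconj (cis (INR j * step N) ^ m))%C) N = RtoC 0 :> C.
Proof.
intros Hkm Hm.
assert (PN : 0 < INR (S N)) by (apply lt_0_INR; lia).
assert (PP := PI_RGT_0).
set (x := INR (m - k) * step N).
assert (Hx : 0 < x < 2 * PI).
{ assert (A : 0 < INR (m - k)) by (apply lt_0_INR; lia).
  assert (B : INR (m - k) < INR (S N)) by (apply lt_INR; lia).
  unfold x, step. split.
  - apply Rmult_lt_0_compat; auto. apply Rdiv_lt_0_compat; lra.
  - apply Rmult_lt_reg_r with (INR (S N)); auto.
    replace (INR (m - k) * (2 * PI / INR (S N)) * INR (S N)) with (INR (m - k) * (2 * PI))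
      by (field; lra). nra. }
assert (G := geometric_sum (Cconj (cis x)) N).
replace (csum _ N) with (csum (fun j => (Cconj (cis x) ^ j)%C) N).
2:{ apply csum_ext. intros j. rewrite Cconj_cis, !cis_pow, Cconj_cis, <- cis_plus. f_equal.
    unfold x. rewrite minus_INR by lia. ring. }
replace (Cconj (cis x) ^ S N)%C with (RtoC 1) in G.
2:{ rewrite <- Cpow_conj, cis_pow. unfold x, step.
    replace (INR (S N) * (INR (m - k) * (2 * PI / INR (S N)))) with (0 + 2 * INR (m - k) * PI)
      by (field; lra).
    unfold cis. rewrite cos_period, sin_period, cos_0, sin_0.
    apply injective_projections; simpl; ring. }
replace (RtoC 1 - RtoC 1)%C with (RtoC 0) in G by ring.
destruct (Ceq_dec (csum (fun j => (Cconj (cis x) ^ j)%C) N) (RtoC 0)) as [E|NE]; auto.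
exfalso. apply (Cmult_neq_0 _ _) in G; auto.
intros E. apply (cis_neq_1 x Hx).
rewrite <- (Cconj_conj (cis x)).
replace (Cconj (cis x)) with (RtoC 1 - (RtoC 1 - Cconj (cis x)))%C by ring.
rewrite E. apply injective_projections; simpl; ring.
Qed.

Lemma Cmod_sq_plus (u v : C) :
  Cmod (u + v) ^ 2 = Cmod u ^ 2 + Cmod v ^ 2 + 2 * Re (u * Cconj v)%C.
Proof. rewrite !Cmod_sq. unfold Re, Im; simpl. ring. Qed.

(** The discrete Parseval identity, by induction on the degree: each new
    monomial is orthogonal to the preceding ones on the roots of unity. *)
Lemma parseval N m (c : nat -> C) : (m <= N)%nat ->
  sum_n (fun j => Cmod (csum (fun k => (c k * cis (INR j * step N) ^ k)%C) m) ^ 2) N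
  = INR (S N) * sum_n (fun k => Cmod (c k) ^ 2) m.
Proof.
set (q := fun j => cis (INR j * step N)).
assert (Q : forall j k, Cmod (q j ^ k) = 1) by (intros; unfold q; now rewrite Cmod_pow, Cmod_cis, pow1).
assert (Orth : forall n M, (n < M)%nat -> (M <= N)%nat ->
  csum (fun j => (csum (fun k => (c k * q j ^ k)%C) n * Cconj (q j ^ M))%C) N = RtoC 0 :> C).
{ induction n as [|n IH]; intros M HM HN.
  - transitivity (csum (fun j => (c O * (q j ^ O * Cconj (q j ^ M)))%C) N).
    + apply csum_ext. intros j. rewrite csum_O. ring.
    + rewrite csum_scal. unfold q. rewrite roots_orthogonal by lia. ring.
  - transitivity (csum (fun j => (csum (fun k => (c k * q j ^ k)%C) n * Cconj (q j ^ M)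
                     + c (S n) * (q j ^ S n * Cconj (q j ^ M)))%C) N).
    + apply csum_ext. intros j. rewrite csum_S. ring.
    + rewrite csum_plus, csum_scal, IH by lia. unfold q. rewrite roots_orthogonal by lia. ring. }
induction m as [|m IH]; intros Hm.
- rewrite sum_O, <- sum_n_cst. apply rsum_ext. intros j.
  rewrite csum_O. fold (q j). rewrite Cmod_mult, Q. ring.
- rewrite sum_n_S, Rmult_plus_distr_l, <- IH by lia.
  transitivity (sum_n (fun j => Cmod (csum (fun k => (c k * q j ^ k)%C) m) ^ 2
    + (Cmod (c (S m)) ^ 2 +
       2 * Re (Cconj (c (S m)) * (csum (fun k => (c k * q j ^ k)%C) m * Cconj (q j ^ S m)))%C)) N).
  + apply rsum_ext. intros j.
    fold (q j). rewrite csum_S, Cmod_sq_plus, Cmod_mult, Q, Cmult_conj.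
    set (p := csum _ m). change C in (type of p).
    replace (p * (Cconj (c (S m)) * Cconj (q j ^ S m)))%C
      with (Cconj (c (S m)) * (p * Cconj (q j ^ S m)))%C by ring.
    ring.
  + rewrite !sum_n_add, sum_n_cst, sum_n_scal, <- Re_csum, csum_scal, Orth by lia.
    replace (Re (Cconj (c (S m)) * RtoC 0)%C) with 0 by (unfold Re; simpl; ring).
    rewrite Rmult_0_r, Rplus_0_r. reflexivity.
Qed.

(** * Means over circles in the Bergman space *)

Lemma in_dom_circle r x : 0 <= r < 1 -> in_dom 1 (RtoC r * cis x)%C.
Proof.
intros Hr. left. rewrite Cmod_mult, Cmod_R, Cmod_cis, Rabs_pos_eq; lra.
Qed.

Definition circle {r : R} (Hr : 0 <= r < 1) (x : R) : dom 1 :=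
  exist _ _ (in_dom_circle r x Hr).

(** The mean of [|f|^2] over [N+1] equidistant points of the circle of radius [r]. *)
Definition mean_sq {r : R} (Hr : 0 <= r < 1) (f : dom 1 -> C) (N : nat) : R :=
  / INR (S N) * sum_n (fun j => Cmod (f (circle Hr (INR j * step N))) ^ 2) N.

Lemma mean_sq_poly {r : R} (Hr : 0 <= r < 1) a N :
  mean_sq Hr (taylor 1 a N) N = sum_n (fun k => Cmod (a k) ^ 2 * (r ^ 2) ^ k) N.
Proof.
assert (PN : 0 < INR (S N)) by (apply lt_0_INR; lia).
unfold mean_sq.
transitivity (/ INR (S N) * (INR (S N) * sum_n (fun k => Cmod (a k * RtoC r ^ k)%C ^ 2) N)).
- f_equal. rewrite <- (parseval N N) by lia. apply rsum_ext. intros j. f_equal. f_equal.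
  unfold taylor. apply csum_ext. intros k. unfold circle, pt; simpl proj1_sig.
  rewrite Cpow_mult_l. ring.
- rewrite <- Rmult_assoc, Rinv_l, Rmult_1_l by lra. apply rsum_ext. intros k.
  rewrite Cmod_mult, Cmod_pow, Cmod_R, Rabs_pos_eq, Rpow_mult_distr, <- !pow_mult by lra.
  now rewrite Nat.mul_comm.
Qed.

Lemma mean_sq_le {r : R} (Hr : 0 <= r < 1) f g N :
  (forall w, Cmod (f w) <= Cmod (g w)) -> mean_sq Hr f N <= mean_sq Hr g N.
Proof.
intros H. unfold mean_sq. apply Rmult_le_compat_l.
- apply Rlt_le, Rinv_0_lt_compat, lt_0_INR. lia.
- apply sum_n_mono. intros k _. apply pow_incr. split; [apply Cmod_ge_0 | apply H].
Qed.

Lemma weight_1 k : weight 1 k = / INR (S k).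
Proof.
assert (0 < INR (S k)) by (apply lt_0_INR; lia).
unfold weight. rewrite Rpower_Ropp, Rpower_1; auto.
Qed.

Lemma Bergman_coef_sq_le f a k : has_coef 1 f a ->
  Cmod (a k) ^ 2 <= INR (S k) * hnorm Bergman f ^ 2.
Proof.
intros Ha. assert (PN : 0 < INR (S k)) by (apply lt_0_INR; lia).
unfold Bergman. rewrite (Hs_norm_sq 1 f a Ha).
assert (T := weighted_term_le 1 a k (proj1 Ha)). rewrite weight_1 in T.
apply (Rmult_le_compat_l (INR (S k))) in T; [|lra].
now rewrite <- Rmult_assoc, Rinv_r, Rmult_1_l in T by lra.
Qed.

Lemma Bergman_coef_le f a k : has_coef 1 f a ->
  Cmod (a k) <= INR (S k) * hnorm Bergman f.
Proof.
intros Ha. assert (L := Bergman_coef_sq_le f a k Ha).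
assert (PN : 1 <= INR (S k)) by (rewrite S_INR; assert (P := pos_INR k); lra).
assert (PH := hnorm_nonneg Bergman f).
apply Rsqr_incr_0; [|apply Cmod_ge_0 | apply Rmult_le_pos; lra].
rewrite !Rsqr_pow2, Rpow_mult_distr. eapply Rle_trans; [apply L|].
apply Rmult_le_compat_r; [apply pow2_ge_0 | nra].
Qed.

(** The mean of the squared modulus of the Taylor polynomial of degree [N] is
    exact by Parseval, and the remainder is at most the norm of [f] times a tail
    of the series of [(k+1) r^k]. The error [e] does not depend on [f], which
    makes the approximation uniform on bounded sets. *)
Lemma mean_sq_approx {r : R} (Hr : 0 <= r < 1) :
  exists e : nat -> R, is_lim_seq e 0 /\ forall f a N, has_coef 1 f a ->
    Rabs (mean_sq Hr f N - sum_n (fun k => Cmod (a k) ^ 2 * (r ^ 2) ^ k) N)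
    <= e N * hnorm Bergman f ^ 2.
Proof.
set (kap := fun k => INR (S k) * r ^ k).
assert (Pk : forall k, 0 <= kap k).
{ intros k. apply Rmult_le_pos; [apply pos_INR | apply pow_le; lra]. }
assert (Ek : ex_series kap).
{ apply ex_series_ext with (fun n => Rpower (INR (S n)) 1 * r ^ n).
  - intros n. unfold kap. rewrite Rpower_1; auto. apply lt_0_INR; lia.
  - now apply geom_power_series. }
set (K := Series kap). set (T := fun N => K - sum_n kap N).
assert (LT : is_lim_seq T 0).
{ replace 0 with (K - K) by ring. apply is_lim_seq_minus'; [apply is_lim_seq_const|].
  apply (Series_correct _ Ek). }
assert (PT : forall N, 0 <= T N).
{ intros N. assert (A := sum_n_le_Series kap N Pk Ek). unfold T, K. lra. }
exists (fun N => T N * (2 * K + T N)). split.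
{ replace 0 with (0 * (2 * K + 0)) by ring.
  apply is_lim_seq_mult'; auto. apply is_lim_seq_plus'; auto. apply is_lim_seq_const. }
intros f a N Ha. set (h := hnorm Bergman f).
assert (Ph : 0 <= h) by apply hnorm_nonneg.
assert (PN : 0 < INR (S N)) by (apply lt_0_INR; lia).
assert (B : forall z k, Cmod z = r -> Cmod (a k * z ^ k)%C <= h * kap k).
{ intros z k Hz. rewrite Cmod_mult, Cmod_pow, Hz. unfold kap.
  rewrite <- Rmult_assoc, (Rmult_comm h). apply Rmult_le_compat_r; [apply pow_le; lra|].
  now apply Bergman_coef_le with (f := f). }
assert (Pl : forall x : dom 1, Cmod (pt x) = r -> forall n, Cmod (taylor 1 a n x) <= h * sum_n kap n).
{ intros x Hx. induction n as [|n IH]; unfold taylor in *.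
  - rewrite csum_O, sum_O. now apply B.
  - rewrite csum_S, sum_n_S. eapply Rle_trans; [apply Cmod_triangle|].
    specialize (B (pt x) (S n) Hx). lra. }
assert (Pd : forall x : dom 1, Cmod (pt x) = r -> forall n,
  Cmod (taylor 1 a (N + n) x - taylor 1 a N x)%C <= h * (sum_n kap (N + n) - sum_n kap N)).
{ intros x Hx. induction n as [|n IH].
  - rewrite Nat.add_0_r. replace (taylor 1 a N x - taylor 1 a N x)%C with (RtoC 0) by ring.
    rewrite Cmod_0. lra.
  - rewrite Nat.add_succ_r, sum_n_S. unfold taylor in *. rewrite csum_S.
    match goal with |- Cmod (?p + ?t - ?o)%C <= _ => replace (p + t - o)%C with ((p - o) + t)%C by ring end.
    eapply Rle_trans; [apply Cmod_triangle|].
    specialize (B (pt x) (S (N + n)) Hx). lra. }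
assert (Pf : forall x : dom 1, Cmod (pt x) = r -> Cmod (f x - taylor 1 a N x)%C <= h * T N).
{ intros x Hx. destruct (eval_bounded _ Bergman x) as [E HE].
  assert (L := poly_approx 1 f a Ha).
  apply (is_lim_seq_le (fun _ => Cmod (f x - taylor 1 a N x)%C)
    (fun n => E * hnorm (Hs 1) (fun x => (f x - taylor 1 a (n + N) x)%C) + h * T N)
    (Cmod (f x - taylor 1 a N x)%C) (h * T N)).
  - intros n.
    replace (f x - taylor 1 a N x)%C with
      ((f x - taylor 1 a (n + N) x) + (taylor 1 a (n + N) x - taylor 1 a N x))%C by ring.
    eapply Rle_trans; [apply Cmod_triangle|]. apply Rplus_le_compat.
    + apply (HE (fun x => (f x - taylor 1 a (n + N) x)%C)).
      eexists. apply (has_coef_minus 1 _ _ _ _ Ha (has_coef_poly 1 a (n + N))).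
    + rewrite Nat.add_comm. eapply Rle_trans; [now apply Pd|].
      apply Rmult_le_compat_l; auto. unfold T, K.
      assert (A := sum_n_le_Series kap (N + n) Pk Ek). lra.
  - apply is_lim_seq_const.
  - replace (Finite (h * T N)) with (Finite (E * 0 + h * T N)) by (f_equal; ring).
    apply is_lim_seq_plus'; [|apply is_lim_seq_const].
    apply is_lim_seq_mult'; [apply is_lim_seq_const|].
    apply (is_lim_seq_incr_n (fun n => hnorm (Hs 1) (fun x => (f x - taylor 1 a n x)%C)) N 0).
    exact L. }
rewrite <- (mean_sq_poly Hr). unfold mean_sq.
rewrite <- Rmult_minus_distr_l.
set (F := fun j => Cmod (f (circle Hr (INR j * step N))) ^ 2).
set (P := fun j => Cmod (taylor 1 a N (circle Hr (INR j * step N))) ^ 2).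
assert (D : forall j, Rabs (F j - P j) <= T N * (2 * K + T N) * h ^ 2).
{ intros j. set (x := circle Hr (INR j * step N)).
  assert (Hx : Cmod (pt x) = r).
  { unfold x, pt; simpl. rewrite Cmod_mult, Cmod_R, Cmod_cis, Rabs_pos_eq; lra. }
  assert (A1 := Pf x Hx). assert (A2 := Pl x Hx N).
  assert (A3 := sum_n_le_Series kap N Pk Ek). fold K in A3.
  assert (A4 := Cmod_triangle (f x - taylor 1 a N x)%C (taylor 1 a N x)).
  replace (f x - taylor 1 a N x + taylor 1 a N x)%C with (f x) in A4 by ring.
  assert (A5 := Cmod_triangle (Copp (f x - taylor 1 a N x))%C (f x)).
  rewrite Cmod_opp in A5.
  replace (- (f x - taylor 1 a N x) + f x)%C with (taylor 1 a N x) in A5 by ring.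
  unfold F, P. fold x.
  assert (B1 := Cmod_ge_0 (f x)). assert (B2 := Cmod_ge_0 (taylor 1 a N x)).
  assert (A6 : h * sum_n kap N <= h * K) by (now apply Rmult_le_compat_l).
  set (u := Cmod (f x)) in *. set (v := Cmod (taylor 1 a N x)) in *.
  set (d := Cmod (f x - taylor 1 a N x)%C) in *.
  replace (u ^ 2 - v ^ 2) with ((u - v) * (u + v)) by ring.
  rewrite Rabs_mult, (Rabs_pos_eq (u + v)) by lra.
  replace (T N * (2 * K + T N) * h ^ 2) with ((h * T N) * (2 * (h * K) + h * T N)) by ring.
  apply Rmult_le_compat; [apply Rabs_pos | lra | apply Rabs_le; lra | lra]. }
rewrite Rabs_mult, Rabs_pos_eq by (apply Rlt_le, Rinv_0_lt_compat; lra).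
assert (DS : Rabs (sum_n F N - sum_n P N) <= INR (S N) * (T N * (2 * K + T N) * h ^ 2)).
{ apply Rabs_le. rewrite <- sum_n_cst. split.
  - assert (A : sum_n P N <= sum_n (fun j => F j + T N * (2 * K + T N) * h ^ 2) N).
    { apply sum_n_mono. intros j _. specialize (D j). apply Rabs_le_between in D. lra. }
    rewrite sum_n_add in A. lra.
  - assert (A : sum_n F N <= sum_n (fun j => P j + T N * (2 * K + T N) * h ^ 2) N).
    { apply sum_n_mono. intros j _. specialize (D j). apply Rabs_le_between in D. lra. }
    rewrite sum_n_add in A. lra. }
apply (Rmult_le_compat_l (/ INR (S N))) in DS; [|apply Rlt_le, Rinv_0_lt_compat; lra].
now rewrite <- Rmult_assoc, Rinv_l, Rmult_1_l in DS by lra.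
Qed.

Lemma sq_coef_series f a t : has_coef 1 f a -> 0 <= t < 1 ->
  ex_series (fun k => Cmod (a k) ^ 2 * t ^ k).
Proof.
intros Ha Ht.
apply (ex_series_le_R _ (fun k => hnorm Bergman f ^ 2 * (Rpower (INR (S k)) 1 * t ^ k))).
- intros k. assert (Pt : 0 <= t ^ k) by (apply pow_le; lra).
  rewrite Rabs_pos_eq by (apply Rmult_le_pos; [apply pow2_ge_0 | auto]).
  rewrite Rpower_1 by (apply lt_0_INR; lia).
  rewrite <- Rmult_assoc, (Rmult_comm (hnorm _ _ ^ 2)). apply Rmult_le_compat_r; auto.
  now apply Bergman_coef_sq_le.
- apply (ex_series_scal (V := R_NormedModule)). now apply geom_power_series.
Qed.

(** Both sides are limits of means over equidistant points of the circle of
    radius [sqrt t]. *)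
Lemma sq_coef_domination f g a b t : has_coef 1 f a -> has_coef 1 g b ->
  (forall w, Cmod (f w) <= Cmod (g w)) -> 0 <= t < 1 ->
  PSeries (fun k => Cmod (a k) ^ 2) t <= PSeries (fun k => Cmod (b k) ^ 2) t.
Proof.
intros Ha Hb D Ht.
assert (Hr : 0 <= sqrt t < 1).
{ split; [apply sqrt_pos|]. rewrite <- sqrt_1. apply sqrt_lt_1; lra. }
destruct (mean_sq_approx Hr) as [e [Le He]].
rewrite pow2_sqrt in He by lra.
set (F := hnorm Bergman f ^ 2). set (G := hnorm Bergman g ^ 2).
apply (is_lim_seq_le (sum_n (fun k => Cmod (a k) ^ 2 * t ^ k))
  (fun N => sum_n (fun k => Cmod (b k) ^ 2 * t ^ k) N + e N * (F + G))
  (PSeries (fun k => Cmod (a k) ^ 2) t) (PSeries (fun k => Cmod (b k) ^ 2) t)).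
- intros N.
  assert (A := He f a N Ha). assert (B := He g b N Hb). fold F in A. fold G in B.
  apply Rabs_le_between in A. apply Rabs_le_between in B.
  assert (M := mean_sq_le Hr f g N D). lra.
- exact (Series_correct _ (sq_coef_series f a t Ha Ht)).
- replace (Finite (PSeries (fun k => Cmod (b k) ^ 2) t))
    with (Finite (PSeries (fun k => Cmod (b k) ^ 2) t + 0 * (F + G))) by (f_equal; ring).
  apply is_lim_seq_plus'.
  + exact (Series_correct _ (sq_coef_series g b t Hb Ht)).
  + apply is_lim_seq_mult'; auto. apply is_lim_seq_const.
Qed.

Lemma sq_coef_CV_radius f a t : has_coef 1 f a -> 0 <= t < 1 ->
  Rbar_lt (Rabs t) (CV_radius (fun k => Cmod (a k) ^ 2)).
Proof.
intros Ha Ht. rewrite Rabs_pos_eq by lra.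
set (y := (1 + t) / 2).
apply Rbar_lt_le_trans with y; [unfold y; simpl; lra|].
apply Rbar_not_lt_le. intros L.
apply (CV_disk_outside (fun k => Cmod (a k) ^ 2) y).
- rewrite Rabs_pos_eq by (unfold y; lra). exact L.
- apply ex_series_lim_0. apply (sq_coef_series f a y Ha). unfold y; lra.
Qed.

(** * Dominated convergence in the Bergman space *)

(** The contribution of the annulus [t < |w|^2 < 1] to the squared Bergman norm
    of the function with coefficients [a]: the factor [(1 - t^(k+1)) / (k+1)] is
    the integral of [x^k] over [[t, 1]]. *)
Definition outer (t : R) (a : nat -> C) : R :=
  Series (fun k => weight 1 k * Cmod (a k) ^ 2 * (1 - t ^ S k)).

Lemma pow_S_bounds t k : 0 <= t <= 1 -> 0 <= t ^ S k <= 1.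
Proof.
intros Ht. split; [apply pow_le; lra|]. rewrite <- (pow1 (S k)). apply pow_incr; lra.
Qed.

Lemma one_minus_pow_le t k : 0 <= t <= 1 -> 1 - t ^ k <= INR k * (1 - t).
Proof.
intros Ht. induction k as [|k IH]; [simpl; lra|].
rewrite S_INR. simpl pow.
assert (0 <= t ^ k <= 1).
{ split; [apply pow_le; lra|]. rewrite <- (pow1 k). apply pow_incr; lra. }
assert (0 <= (1 - t) * (1 - t ^ k)) by (apply Rmult_le_pos; lra). nra.
Qed.

Lemma outer_term_bounds t a k : 0 <= t <= 1 ->
  0 <= weight 1 k * Cmod (a k) ^ 2 * (1 - t ^ S k) <= weight 1 k * Cmod (a k) ^ 2.
Proof.
intros Ht. assert (P := weight_sq_nonneg 1 a k). assert (Q := pow_S_bounds t k Ht).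
split; [apply Rmult_le_pos; lra|].
rewrite <- (Rmult_1_r (weight 1 k * Cmod (a k) ^ 2)) at 2. apply Rmult_le_compat_l; lra.
Qed.

Lemma outer_series f a t : has_coef 1 f a -> 0 <= t <= 1 ->
  ex_series (fun k => weight 1 k * Cmod (a k) ^ 2 * (1 - t ^ S k)).
Proof.
intros Ha Ht.
apply (ex_series_le_R _ (fun k => weight 1 k * Cmod (a k) ^ 2)); [|apply Ha].
intros k. assert (B := outer_term_bounds t a k Ht). rewrite Rabs_pos_eq; lra.
Qed.

Lemma PS_Int_sq f a t : has_coef 1 f a -> 0 <= t < 1 ->
  is_series (fun k => weight 1 k * Cmod (a k) ^ 2 * t ^ S k)
    (PSeries (PS_Int (fun k => Cmod (a k) ^ 2)) t).
Proof.
intros Ha Ht.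
assert (E : ex_series (fun k => weight 1 k * Cmod (a k) ^ 2 * t ^ S k)).
{ apply (ex_series_le_R _ (fun k => weight 1 k * Cmod (a k) ^ 2)); [|apply Ha].
  intros k. assert (P := weight_sq_nonneg 1 a k).
  assert (Q := pow_S_bounds t k ltac:(lra)).
  rewrite Rabs_pos_eq by (apply Rmult_le_pos; lra).
  rewrite <- (Rmult_1_r (weight 1 k * Cmod (a k) ^ 2)) at 2. apply Rmult_le_compat_l; lra. }
assert (T : forall k, PS_Int (fun k => Cmod (a k) ^ 2) (S k) * t ^ S k
  = weight 1 k * Cmod (a k) ^ 2 * t ^ S k).
{ intros k. rewrite weight_1. unfold PS_Int. unfold Rdiv. ring. }
unfold PSeries. rewrite Series_incr_1.
- simpl (PS_Int _ 0). rewrite Rmult_0_l, Rplus_0_l.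
  rewrite (Series_ext _ _ T). now apply Series_correct.
- apply ex_series_incr_1. revert E. apply ex_series_ext. intros k. now rewrite T.
Qed.

Lemma outer_0 f a : has_coef 1 f a -> outer 0 a = hnorm Bergman f ^ 2.
Proof.
intros Ha. unfold Bergman. rewrite (Hs_norm_sq 1 f a Ha). unfold outer.
apply Series_ext. intros k. rewrite pow_i by lia. ring.
Qed.

(** Integration of [sq_coef_domination] over [[t, R]], followed by [R -> 1]. *)
Lemma outer_domination f g a b t : has_coef 1 f a -> has_coef 1 g b ->
  (forall w, Cmod (f w) <= Cmod (g w)) -> 0 <= t < 1 -> outer t a <= outer t b.
Proof.
intros Ha Hb D Ht.
set (I := fun c => PSeries (PS_Int (fun k => Cmod (c k) ^ 2))).
assert (Int : forall h c, has_coef 1 h c -> forall R, t <= R < 1 ->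
  is_RInt (PSeries (fun k => Cmod (c k) ^ 2)) t R (I c R - I c t)).
{ intros h c Hc R HR.
  assert (A := is_RInt_PSeries _ _ (sq_coef_CV_radius h c t Hc Ht)).
  assert (B := is_RInt_PSeries _ _ (sq_coef_CV_radius h c R Hc ltac:(lra))).
  apply is_RInt_swap in A. assert (Ch := is_RInt_Chasles _ _ _ _ _ _ A B).
  replace (I c R - I c t) with (plus (opp (I c t)) (I c R)); [exact Ch|].
  change (- I c t + I c R = I c R - I c t). ring. }
assert (Dif : forall h c, has_coef 1 h c -> forall R, t <= R < 1 ->
  is_series (fun k => weight 1 k * Cmod (c k) ^ 2 * (R ^ S k - t ^ S k)) (I c R - I c t)).
{ intros h c Hc R HR.
  generalize (is_series_minus (V := R_NormedModule) _ _ _ _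
    (PS_Int_sq h c R Hc ltac:(lra)) (PS_Int_sq h c t Hc Ht)).
  apply is_series_ext. intros k.
  change (weight 1 k * Cmod (c k) ^ 2 * R ^ S k - weight 1 k * Cmod (c k) ^ 2 * t ^ S k
    = weight 1 k * Cmod (c k) ^ 2 * (R ^ S k - t ^ S k)). ring. }
set (u := fun k => weight 1 k * Cmod (a k) ^ 2).
assert (Pu : forall k, 0 <= u k) by (apply weight_sq_nonneg).
assert (Step : forall R N, t <= R < 1 ->
  sum_n (fun k => u k * (R ^ S k - t ^ S k)) N <= outer t b).
{ intros R N HR.
  apply Rle_trans with (I a R - I a t).
  { rewrite <- (is_series_unique _ _ (Dif f a Ha R HR)). apply sum_n_le_Series.
    - intros k. apply Rmult_le_pos; [apply Pu|].
      assert (t ^ S k <= R ^ S k) by (apply pow_incr; lra). lra.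
    - eexists. now apply (Dif f a Ha R HR). }
  apply Rle_trans with (I b R - I b t).
  { rewrite <- (is_RInt_unique _ _ _ _ (Int f a Ha R HR)),
      <- (is_RInt_unique _ _ _ _ (Int g b Hb R HR)).
    apply RInt_le; [lra | eexists; now apply (Int f a Ha) | eexists; now apply (Int g b Hb) |].
    intros x Hx. apply (sq_coef_domination f g); auto; lra. }
  rewrite <- (is_series_unique _ _ (Dif g b Hb R HR)). unfold outer.
  apply Series_le.
  - intros k. assert (P := weight_sq_nonneg 1 b k).
    assert (t ^ S k <= R ^ S k) by (apply pow_incr; lra).
    assert (Q := pow_S_bounds R k ltac:(lra)).
    split; [apply Rmult_le_pos; lra | apply Rmult_le_compat_l; lra].
  - apply (outer_series g b t Hb). lra. }
apply bounded_series.
{ intros k. apply outer_term_bounds. lra. }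
intros N. apply le_epsilon. intros eps He.
set (U := INR (S N) * sum_n u N).
assert (PS : 0 <= sum_n u N).
{ eapply Rle_trans; [apply (Pu N) | now apply term_le_sum_n]. }
assert (PU : 0 <= U) by (apply Rmult_le_pos; auto; apply pos_INR).
(* A radius with [(1 - R) U <= eps] *)
set (R := Rmax t (1 - eps / (U + 1))).
assert (HR : t <= R < 1).
{ split; [apply Rmax_l|]. apply Rmax_lub_lt; [lra|].
  assert (0 < eps / (U + 1)) by (apply Rdiv_lt_0_compat; lra). lra. }
assert (HU : (1 - R) * U <= eps).
{ assert (A := Rmax_r t (1 - eps / (U + 1))). fold R in A.
  apply Rle_trans with (eps / (U + 1) * (U + 1)).
  - apply Rmult_le_compat; lra.
  - apply Req_le. field. lra. }
apply Rle_trans with (sum_n (fun k => u k * (R ^ S k - t ^ S k) + INR (S N) * (1 - R) * u k) N).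
- apply sum_n_mono. intros k Hk. fold (u k).
  assert (A := one_minus_pow_le R (S k) ltac:(lra)).
  assert (B : INR (S k) * (1 - R) <= INR (S N) * (1 - R)).
  { apply Rmult_le_compat_r; [lra | apply le_INR; lia]. }
  specialize (Pu k).
  replace (u k * (R ^ S k - t ^ S k) + INR (S N) * (1 - R) * u k)
    with (u k * (R ^ S k - t ^ S k + INR (S N) * (1 - R))) by ring.
  apply Rmult_le_compat_l; lra.
- rewrite sum_n_add, sum_n_scal. specialize (Step R N HR). unfold U in HU. lra.
Qed.

Lemma outer_small g b eps : has_coef 1 g b -> 0 < eps ->
  exists t, 0 <= t < 1 /\ outer t b <= eps.
Proof.
intros Hb He. set (u := fun k => weight 1 k * Cmod (b k) ^ 2).
assert (Pu : forall k, 0 <= u k) by (apply weight_sq_nonneg).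
assert (Eu : ex_series u) by apply Hb.
assert (L : is_lim_seq (sum_n u) (Series u)) by exact (Series_correct _ Eu).
apply is_lim_seq_spec in L. destruct (L (mkposreal (eps / 2) ltac:(lra))) as [N HN].
specialize (HN N (Nat.le_refl N)). simpl in HN. apply Rabs_lt_between in HN.
set (S0 := INR (S N) * sum_n u N).
assert (PS : 0 <= sum_n u N).
{ eapply Rle_trans; [apply (Pu N) | now apply term_le_sum_n]. }
assert (PS0 : 0 <= S0) by (apply Rmult_le_pos; auto; apply pos_INR).
set (t := Rmax 0 (1 - eps / 2 / (S0 + 1))).
assert (Ht : 0 <= t < 1).
{ split; [apply Rmax_l|]. apply Rmax_lub_lt; [lra|].
  assert (0 < eps / 2 / (S0 + 1)) by (apply Rdiv_lt_0_compat; lra). lra. }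
assert (HS : (1 - t) * S0 <= eps / 2).
{ assert (A := Rmax_r 0 (1 - eps / 2 / (S0 + 1))). fold t in A.
  apply Rle_trans with (eps / 2 / (S0 + 1) * (S0 + 1)).
  - apply Rmult_le_compat; lra.
  - apply Req_le. field. lra. }
exists t. split; auto.
(* The terms up to [N] are small since [t] is close to [1], the others since the series converges. *)
set (v := fun k => if Nat.leb k N then u k * (INR (S N) * (1 - t)) - u k else 0).
assert (Sv : is_series v (sum_n v N)).
{ apply is_series_finite. intros k Hk. unfold v. now rewrite (proj2 (Nat.leb_gt k N) Hk). }
assert (Ev : sum_n v N = (INR (S N) * (1 - t) - 1) * sum_n u N).
{ rewrite <- sum_n_scal. apply sum_n_ext_loc. intros k Hk. unfold v.
  rewrite (proj2 (Nat.leb_le k N) Hk).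
  match goal with |- @eq _ ?x ?y => change (@eq R x y) end. ring. }
apply Rle_trans with (Series (fun k => u k + v k)).
- apply Series_le.
  + intros k. assert (B := outer_term_bounds t b k ltac:(lra)). split; [lra|].
    fold (u k) in *. unfold v. destruct (Nat.leb_spec k N) as [Hk|Hk]; [|lra].
    assert (A := one_minus_pow_le t (S k) ltac:(lra)).
    assert (C0 : INR (S k) * (1 - t) <= INR (S N) * (1 - t)).
    { apply Rmult_le_compat_r; [lra | apply le_INR; lia]. }
    replace (u k + (u k * (INR (S N) * (1 - t)) - u k)) with (u k * (INR (S N) * (1 - t))) by ring.
    apply Rmult_le_compat_l; [apply Pu | lra].
  + apply (ex_series_plus (V := R_NormedModule) u v); auto. eexists; exact Sv.
- rewrite Series_plus, (is_series_unique _ _ Sv), Ev by (auto; eexists; exact Sv).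
  unfold S0 in HS. lra.
Qed.

(** Up to an error that is uniform in [n], the coefficient is bounded by a mean
    over finitely many points, and there pointwise convergence suffices. *)
Lemma coef_tends_to_0 (g : nat -> dom 1 -> C) (a : nat -> nat -> C) A k :
  (forall n, has_coef 1 (g n) (a n)) -> (forall n, hnorm Bergman (g n) ^ 2 <= A) ->
  (forall w, is_lim_seq (fun n => Cmod (g n w)) 0) ->
  is_lim_seq (fun n => Cmod (a n k) ^ 2) 0.
Proof.
intros Ha HA HL.
assert (Hr : 0 <= / 2 < 1) by lra.
destruct (mean_sq_approx Hr) as [e [Le He]].
assert (P2 : 0 < ((/ 2) ^ 2) ^ k) by (apply pow_lt; lra).
assert (PA : 0 <= A) by (eapply Rle_trans; [apply pow2_ge_0 | apply (HA O)]).
apply is_lim_seq_spec. intros eps. destruct eps as [eps Pe]. simpl.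
set (d := eps * ((/ 2) ^ 2) ^ k / 2).
assert (Pd : 0 < d) by (unfold d; apply Rmult_lt_0_compat; [apply Rmult_lt_0_compat; lra | lra]).
(* A number [N >= k] of points for which the error of the quadrature is small *)
assert (EN : exists N, (k <= N)%nat /\ Rabs (e N) * A < d).
{ assert (L : is_lim_seq (fun N => e N * A) 0).
  { replace (Finite 0) with (Finite (0 * A)) by (f_equal; ring).
    apply is_lim_seq_mult'; auto. apply is_lim_seq_const. }
  apply is_lim_seq_spec in L. destruct (L (mkposreal d Pd)) as [N HN].
  exists (N + k)%nat. split; [lia|]. specialize (HN (N + k)%nat ltac:(lia)). simpl in HN.
  now rewrite Rminus_0_r, Rabs_mult, (Rabs_pos_eq A) in HN by auto. }
destruct EN as [N [HkN HN]].
assert (LM : is_lim_seq (fun n => mean_sq Hr (g n) N) 0).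
{ replace (Finite 0) with (Finite (/ INR (S N) * 0)) by (f_equal; ring).
  apply is_lim_seq_mult'; [apply is_lim_seq_const|].
  assert (LS : forall M, is_lim_seq
    (fun n => sum_n (fun j => Cmod (g n (circle Hr (INR j * step N))) ^ 2) M) 0).
  { assert (LT : forall w, is_lim_seq (fun n => Cmod (g n w) ^ 2) 0).
    { intros w. apply is_lim_seq_ext with (fun n => Cmod (g n w) * Cmod (g n w)).
      - intros n. ring.
      - replace (Finite 0) with (Finite (0 * 0)) by (f_equal; ring).
        apply is_lim_seq_mult'; apply HL. }
    induction M as [|M IH].
    - apply is_lim_seq_ext with (fun n => Cmod (g n (circle Hr (INR 0 * step N))) ^ 2);
        [intros n; now rewrite sum_O | apply LT].
    - apply is_lim_seq_ext with (fun n =>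
        sum_n (fun j => Cmod (g n (circle Hr (INR j * step N))) ^ 2) M
        + Cmod (g n (circle Hr (INR (S M) * step N))) ^ 2); [intros n; now rewrite sum_n_S |].
      replace (Finite 0) with (Finite (0 + 0)) by (f_equal; ring).
      apply is_lim_seq_plus'; auto. }
  apply LS. }
apply is_lim_seq_spec in LM. destruct (LM (mkposreal d Pd)) as [n0 Hn0].
exists n0. intros n Hn. specialize (Hn0 n Hn). simpl in Hn0.
rewrite Rminus_0_r in *. apply Rabs_lt_between in Hn0.
rewrite Rabs_pos_eq by apply pow2_ge_0.
assert (Hen : e N * hnorm Bergman (g n) ^ 2 <= Rabs (e N) * A).
{ eapply Rle_trans; [apply Rmult_le_compat_r; [apply pow2_ge_0 | apply Rle_abs]|].
  apply Rmult_le_compat_l; [apply Rabs_pos | apply HA]. }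
assert (B := He (g n) (a n) N (Ha n)). apply Rabs_le_between in B.
assert (T : Cmod (a n k) ^ 2 * ((/ 2) ^ 2) ^ k
  <= sum_n (fun k => Cmod (a n k) ^ 2 * ((/ 2) ^ 2) ^ k) N).
{ set (v := fun k => Cmod (a n k) ^ 2 * ((/ 2) ^ 2) ^ k).
  assert (Pv : forall j, 0 <= v j).
  { intros j. apply Rmult_le_pos; [apply pow2_ge_0 | apply pow_le; lra]. }
  change (v k <= sum_n v N). clear -HkN Pv. induction HkN as [|N HN IH].
  - now apply term_le_sum_n.
  - rewrite sum_n_S. specialize (Pv (S N)). lra. }
apply Rmult_lt_reg_r with (((/ 2) ^ 2) ^ k); auto.
assert (D2 : 2 * d = eps * ((/ 2) ^ 2) ^ k) by (unfold d; field).
lra.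
Qed.

(** The contribution of a thin outer annulus is small uniformly in [n], as it is
    dominated by that of [h]. What remains is controlled by finitely many
    coefficients, each of which tends to [0]. *)
Lemma Bergman_dominated_convergence (g : nat -> dom 1 -> C) (a : nat -> nat -> C) h b :
  (forall n, has_coef 1 (g n) (a n)) -> has_coef 1 h b ->
  (forall n w, Cmod (g n w) <= Cmod (h w)) ->
  (forall w, is_lim_seq (fun n => Cmod (g n w)) 0) ->
  is_lim_seq (fun n => hnorm Bergman (g n) ^ 2) 0.
Proof.
intros Ha Hb D HL.
(* For [k > K] the factor [1 - t^(k+1)] is at least [1/2], so twice the outer
   contribution bounds the terms of index greater than [K]. *)
assert (Split : forall n K t, 0 <= t < 1 -> t ^ K <= / 2 ->
  hnorm Bergman (g n) ^ 2
  <= sum_n (fun k => weight 1 k * Cmod (a n k) ^ 2) K + 2 * outer t (a n)).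
{ intros n K t Ht HK. unfold Bergman. rewrite (Hs_norm_sq 1 _ _ (Ha n)).
  set (u := fun k => weight 1 k * Cmod (a n k) ^ 2).
  assert (Pu : forall k, 0 <= u k) by (apply weight_sq_nonneg).
  set (v := fun k => if Nat.leb k K then u k else 0).
  assert (Sv : is_series v (sum_n v K)).
  { apply is_series_finite. intros k Hk. unfold v. now rewrite (proj2 (Nat.leb_gt k K) Hk). }
  assert (Ev : sum_n v K = sum_n u K).
  { apply sum_n_ext_loc. intros k Hk. unfold v. now rewrite (proj2 (Nat.leb_le k K) Hk). }
  assert (So := outer_series (g n) (a n) t (Ha n) ltac:(lra)).
  assert (So2 := ex_series_scal (V := R_NormedModule) 2 _ So).
  apply Rle_trans with (Series (fun k => v k + 2 * (u k * (1 - t ^ S k)))).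
  - apply Series_le.
    + intros k. split; [apply Pu|].
      assert (B := outer_term_bounds t (a n) k ltac:(lra)). fold (u k) in B.
      unfold v. destruct (Nat.leb_spec k K) as [Hk|Hk]; [lra|].
      assert (T : t ^ S k <= / 2).
      { eapply Rle_trans; [|apply HK]. replace (S k) with (K + (S k - K))%nat by lia.
        rewrite pow_add. rewrite <- (Rmult_1_r (t ^ K)) at 2.
        apply Rmult_le_compat_l; [apply pow_le; lra|].
        rewrite <- (pow1 (S k - K)). apply pow_incr; lra. }
      specialize (Pu k). nra.
    + apply (ex_series_plus (V := R_NormedModule) v); [eexists; exact Sv | exact So2].
  - rewrite Series_plus by (exact So2 || (eexists; exact Sv)).
    rewrite (is_series_unique _ _ Sv), Ev, Series_scal_l. apply Rle_refl. }
assert (HA : forall n, hnorm Bergman (g n) ^ 2 <= outer 0 b).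
{ intros n. rewrite <- (outer_0 _ _ (Ha n)). apply (outer_domination (g n) h); auto. lra. }
apply is_lim_seq_spec. intros [eps Pe]. cbn [pos].
destruct (outer_small h b (eps / 4) Hb ltac:(lra)) as [t [Ht Ot]].
destruct (pow_lt_1_zero t) with (y := / 2) as [K HK]; [rewrite Rabs_pos_eq; lra | lra |].
specialize (HK K (Nat.le_refl K)). rewrite Rabs_pos_eq in HK by (apply pow_le; lra).
assert (LS : forall M, is_lim_seq (fun n => sum_n (fun k => weight 1 k * Cmod (a n k) ^ 2) M) 0).
{ assert (LT : forall k, is_lim_seq (fun n => weight 1 k * Cmod (a n k) ^ 2) 0).
  { intros k. replace (Finite 0) with (Finite (weight 1 k * 0)) by (f_equal; ring).
    apply is_lim_seq_mult'; [apply is_lim_seq_const|].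
    apply (coef_tends_to_0 g a (outer 0 b)); auto. }
  induction M as [|M IH].
  - apply is_lim_seq_ext with (fun n => weight 1 0 * Cmod (a n O) ^ 2);
      [intros n; now rewrite sum_O | apply LT].
  - apply is_lim_seq_ext with (fun n =>
      sum_n (fun k => weight 1 k * Cmod (a n k) ^ 2) M + weight 1 (S M) * Cmod (a n (S M)) ^ 2);
      [intros n; now rewrite sum_n_S |].
    replace (Finite 0) with (Finite (0 + 0)) by (f_equal; ring).
    apply is_lim_seq_plus'; auto. }
specialize (LS K). apply is_lim_seq_spec in LS.
destruct (LS (mkposreal (eps / 2) ltac:(lra))) as [n0 Hn0].
exists n0. intros n Hn. specialize (Hn0 n Hn). cbn [pos] in Hn0.
rewrite Rminus_0_r in *. apply Rabs_lt_between in Hn0.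
rewrite Rabs_pos_eq by apply pow2_ge_0.
assert (S1 := Split n K t Ht ltac:(lra)).
assert (O1 := outer_domination (g n) h (a n) b t (Ha n) Hb (D n) Ht). lra.
Qed.

(** * The theorem *)

Theorem claim6p1 : forall s : R, s <= 0 -> ~ weakly_related (Hs s) Bergman.
Proof.
intros s Hs0 [lambda [phi HW]].
assert (Hw := fun h Hh => wco_onto _ _ _ _ HW h Hh).
set (f := fun n => epsilon (inhabits (fun _ : dom 1 => RtoC 0))
  (fun g => mem Bergman g /\ wco lambda phi g = (fun x => (pt x ^ n)%C))).
assert (Hf : forall n, mem Bergman (f n) /\ wco lambda phi (f n) = (fun x => (pt x ^ n)%C)).
{ intros n. unfold f. apply epsilon_spec, Hw. eexists. apply has_coef_pow. }
assert (B := fun w => inverse_monomials_to_zero s Bergman lambda phi f w HW Hf).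
assert (Ml : mem (Hs s) lambda).
{ replace lambda with (wco lambda phi (fun x : dom 1 => (pt x ^ O)%C))
    by (apply functional_extensionality; intros x; unfold wco; simpl; ring).
  apply (wco_mem _ _ _ _ HW). eexists. apply (has_coef_pow 1 O). }
destruct (mul_z_bounded s) as [Bz [_ Mz]].
destruct (Hw _ (proj1 (Mz lambda Ml))) as [tau [Mt Wt]].
assert (Rec : forall w n, f (S n) w = (tau w * f n w)%C).
{ intros w n. apply (conjugate_of_mul_z s 1 lambda phi tau (f n) (f (S n)) HW); auto; try apply Hf.
  - intros x. now rewrite Wt.
  - intros x. rewrite (proj2 (Hf n)), (proj2 (Hf (S n))). reflexivity. }
assert (Pow : forall w n, Cmod (f n w) = Cmod (tau w) ^ n * Cmod (f O w)).
{ intros w. induction n as [|n IH]; [simpl; ring|].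
  rewrite Rec, Cmod_mult, IH. simpl. ring. }
(* Otherwise [(n+1)^s |tau w|^(2n)] would tend to infinity, its reciprocal being
   the general term of a convergent series, and also to [0] by [B]. *)
assert (Contr : forall w, f O w = RtoC 0 \/ Cmod (tau w) <= 1).
{ intros w. destruct (Rle_lt_dec (Cmod (tau w)) 1) as [L|L]; [now right | left].
  apply Cmod_eq_0. set (x := Cmod (tau w)) in *. set (y := Cmod (f O w)).
  assert (Ix : 0 < / x ^ 2 < 1).
  { split; [apply Rinv_0_lt_compat; nra|]. rewrite <- Rinv_1. apply Rinv_lt_contravar; nra. }
  assert (G := ex_series_lim_0 _ (geom_power_series (- s) (/ x ^ 2) ltac:(lra))).
  assert (P := is_lim_seq_mult' _ _ _ _ G (B w)).
  assert (Q : is_lim_seq (fun _ : nat => y ^ 2) (0 * 0)).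
  { revert P. apply is_lim_seq_ext. intros n. rewrite Pow. fold x y.
    assert (E : Rpower (INR (S n)) (- s) * Rpower (INR (S n)) s = 1) by apply (weight_inv s n).
    assert (E2 : (/ x ^ 2) ^ n * (x ^ n) ^ 2 = 1).
    { rewrite <- pow_mult, Nat.mul_comm, pow_mult, <- Rpow_mult_distr, Rinv_l, pow1; auto. nra. }
    transitivity ((Rpower (INR (S n)) (- s) * Rpower (INR (S n)) s)
      * ((/ x ^ 2) ^ n * (x ^ n) ^ 2) * y ^ 2); [ring|]. rewrite E, E2. ring. }
  assert (U := is_lim_seq_unique _ _ Q). rewrite Lim_seq_const in U.
  injection U. intros V. rewrite Rmult_0_l in V.
  assert (Py := Cmod_ge_0 (f O w)). fold y in Py. nra. }
(* The functions [g n] are the inverse images of the normalised monomials. *)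
set (c := fun n => RtoC (Rpower (INR (S n)) (s / 2))).
assert (Pc : forall n, 0 < Rpower (INR (S n)) (s / 2)) by (intros; apply exp_pos).
assert (Nc : forall n, Cmod (c n) ^ 2 = Rpower (INR (S n)) s).
{ intros n. unfold c. rewrite Cmod_R, Rabs_pos_eq by (apply Rlt_le, Pc).
  simpl. rewrite Rmult_1_r, <- Rpower_plus. f_equal. field. }
assert (Lc : forall n, Cmod (c n) <= 1).
{ intros n. unfold c. rewrite Cmod_R, Rabs_pos_eq by (apply Rlt_le, Pc).
  rewrite <- (Rpower_O (INR (S n))) by (apply lt_0_INR; lia).
  apply Rle_Rpower; [|lra]. rewrite S_INR. assert (P := pos_INR n). lra. }
set (g := fun n w => (c n * f n w)%C).
assert (Mg : forall n, mem Bergman (g n)) by (intros n; apply mem_scal, Hf).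
destruct (proj1 (Hf O)) as [b Hb].
assert (Z : is_lim_seq (fun n => hnorm Bergman (g n) ^ 2) 0).
{ apply (Bergman_dominated_convergence g (fun n => coef 1 (g n)) (f O) b); auto.
  - intros n. apply coef_spec, Mg.
  - intros n w. unfold g. rewrite Cmod_mult, Pow.
    assert (P0 := Cmod_ge_0 (f O w)). assert (Pt := Cmod_ge_0 (tau w)).
    destruct (Contr w) as [E|E].
    + rewrite E, Cmod_0. lra.
    + assert (Q : 0 <= Cmod (tau w) ^ n <= 1).
      { split; [now apply pow_le|]. rewrite <- (pow1 n). apply pow_incr. lra. }
      assert (A := Lc n). assert (A' := Cmod_ge_0 (c n)).
      rewrite <- (Rmult_1_l (Cmod (f O w))) at 2. rewrite <- Rmult_assoc.
      apply Rmult_le_compat_r; nra.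
  - intros w. apply is_lim_seq_ext with (fun n => sqrt (Rpower (INR (S n)) s * Cmod (f n w) ^ 2)).
    + intros n. unfold g. rewrite Cmod_mult, <- Nc, <- Rpow_mult_distr, sqrt_pow2; auto.
      apply Rmult_le_pos; apply Cmod_ge_0.
    + rewrite <- sqrt_0. apply is_lim_seq_continuous; [apply continuity_pt_sqrt; lra | apply B]. }
destruct (proj1 HW) as [_ [M HM]].
assert (One : forall n, 1 <= M ^ 2 * hnorm Bergman (g n) ^ 2).
{ intros n. specialize (HM (g n) (Mg n)).
  assert (E : hnorm (Hs s) (wco lambda phi (g n)) = 1).
  { unfold g. rewrite wco_scal, (proj2 (Hf n)).
    assert (Hp := has_coef_pow s n).
    rewrite hnorm_scal by (eexists; exact Hp).
    assert (Np : hnorm (Hs s) (fun x => (pt x ^ n)%C) ^ 2 = weight s n).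
    { rewrite (Hs_norm_sq s _ _ Hp). apply is_series_unique.
      replace (weight s n) with (weight s n * Cmod (delta n n) ^ 2).
      - apply (is_series_single (fun k => weight s k * Cmod (delta n k) ^ 2)).
        intros k Hk. unfold delta. rewrite (proj2 (Nat.eqb_neq n k)), Cmod_0 by auto. ring.
      - unfold delta. rewrite Nat.eqb_refl, Cmod_1. ring. }
    assert (Nn := hnorm_nonneg (Hs s) (fun x => (pt x ^ n)%C)).
    assert (A' := Cmod_ge_0 (c n)).
    rewrite <- (sqrt_pow2 (Cmod (c n) * _)) by (now apply Rmult_le_pos).
    rewrite Rpow_mult_distr, Nc, Np, Rmult_comm, weight_inv. apply sqrt_1. }
  rewrite E in HM. rewrite <- Rpow_mult_distr.
  apply Rle_trans with (1 ^ 2); [lra | apply pow_incr; lra]. }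
assert (L := is_lim_seq_mult' _ _ _ _ (is_lim_seq_const (M ^ 2)) Z).
assert (Le := is_lim_seq_le _ _ _ _ One (is_lim_seq_const 1) L).
simpl in Le. lra.
Qed.
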